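(* For any $X\in\{v\Delta^\wedge,\ v\Delta^\circ,\ v\sharp,\ vp\}$ and any positive integer $m$, there are infinitely many oriented virtual knots $K$ with ${\rm u}_X(K)=m$.
   Context: Virtual knots. An oriented virtual knot diagram is a generic immersion of an oriented circle into the plane, each double point of which is either a real crossing (with over/under information) or a virtual crossing. The generalized Reidemeister moves are: the Reidemeister moves I, II, III for real crossings; their analogues in which all crossings are virtual; and the mixed move in which a strand having two virtual crossings is passed across a real crossing. An oriented virtual knot is an equivalence class of diagrams under generalized Reidemeister moves (and planar isotopy). Virtualized $\Delta$-moves. Consider a disk meeting the diagram in three oriented strands, any two of which cross exactly once, so that the three crossings are the vertices of a triangle. A $v\Delta$-move replaces three real crossings, where each of the three strands passes over at one of its two crossings and under at the other, by three virtual crossings, or is the inverse of this replacement. It is a $v\Delta^\circ$-move if the three sides of the triangle, with the orientations of the strands, form a coherently oriented cycle (equivalently, the three real crossings have the same sign); otherwise it is a $v\Delta^\wedge$-move. Virtualized $\sharp$- and pass-moves. Consider a disk meeting the diagram in a pair of parallel, disjoint strands and another pair of parallel, disjoint strands, where each strand of the first pair crosses each strand of the second pair exactly once. The move in question replaces four real crossings at which both strands of the first pair pass over both strands of the second pair by four virtual crossings, or is the inverse of this replacement. It is a $v\sharp$-move if within each pair the two strands are oriented in the same direction, and a $vp$-move if within each pair the two strands are oriented in opposite directions. $X$-unknotting number. For each such $X$, any oriented virtual knot $K$ can be deformed into the trivial knot $O$ by finitely many $X$-moves and generalized Reidemeister moves; ${\rm u}_X(K)$ is the minimal number of $X$-moves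 required to deform a diagram of $K$ into a diagram of $O$ (generalized Reidemeister moves being used freely). *)

(* Defs.v *)
From mathcomp Require Import all_boot.
From mathcomp Require Import boolp classical_sets cardinality.
From Stdlib Require Import Relation_Operators.
Set Implicit Arguments. Unset Strict Implicit. Unset Printing Implicit Defensive.

(* A diagram is a generic immersed oriented circle in the plane.  Up to planar
   isotopy it is recorded by the cyclic sequence of the passages of the circle
   through its double points (real and virtual alike), cut open at a base point
   that is not a double point, together with the side of the base point on
   which the unbounded region lies.  For a passage through a crossing we record
   from which side the other strand comes; this determines the cyclic order of
   the four half-edges at the crossing, hence a 4-valent map on a closed
   oriented surface, and the sequence comes from a curve in the plane exactly
   when that surface is a sphere. *)

(* A crossing is a name together with its kind: [None] for a virtual crossing,
   [Some s] for a real crossing, positive if [s] and negative otherwise. *)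
Definition crossing : Type := (nat * option bool)%type.
Definition kind (c : crossing) : option bool := c.2.
Definition is_real (c : crossing) : bool := kind c != None.
Definition is_virtual (c : crossing) : bool := kind c == None.

(* [(c, true)] : the other strand of [c] crosses from right to left;
   [(c, false)] : it crosses from left to right.  So the two passages through
   [c] are [(c, true)] and [(c, false)]. *)
Definition passage : Type := (crossing * bool)%type.
Definition other (p : passage) : passage := (p.1, ~~ p.2).

(* At a positive crossing the under-strand crosses the over-strand from right
   to left, at a negative one from left to right. *)
Definition is_over (p : passage) : bool := kind p.1 == Some p.2.

Definition word : Type := seq passage.

Definition wf_word (w : word) : bool :=
  uniq w && all (fun p => other p \in w) w.

(* Edge [i] of [w] is the one that ends at passage [i]; edge [0] carries the
   base point.  The pair [(i, true)] is the left side of edge [i] and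
   [(i, false)] its right side. *)
Definition edge_side (w : word) : Type := ('I_(size w) * bool)%type.

Definition partner (w : word) (i : 'I_(size w)) : 'I_(size w) :=
  insubd i (index (other (tnth (in_tuple w) i)) w).

(* Walk along the edge keeping the region on the left, so forwards on
   [(i, true)] and backwards on [(i, false)], and turn left at the crossing. *)
Definition next_side (w : word) (d : edge_side w) : edge_side w :=
  let k := if d.2 then d.1 else ord_pred d.1 in
  if (tnth (in_tuple w) k).2 == d.2 then (ordS (partner k), true)
  else (partner k, false).

(* The regions of the complement are the orbits of [next_side].  With [n]
   crossings there are [2 * n] edges, so Euler's formula asks for [n + 2]
   regions; a circle without crossings has no vertex and is treated apart. *)
Definition planar (w : word) : bool :=
  nilp w || (fcard (@next_side w) predT == (size w)./2 + 2).

(* [outer] tells whether the unbounded region is on the left of the base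
   point. *)
Record diagram := Diagram {
  code : word;
  outer : bool;
  code_wf : wf_word code;
  code_planar : planar code
}.

(* Two codes of the same curve up to planar isotopy differ by the names of the
   crossings and by the base point. *)

Definition renaming (D D' : diagram) : Prop :=
  exists f : crossing -> crossing,
    [/\ {in map fst (code D) &, injective f},
        forall c, kind (f c) = kind c,
        code D' = [seq (f p.1, p.2) | p <- code D]
      & outer D' = outer D].

(* The new base point must be adjacent to the same unbounded region. *)
Definition rebasing (D D' : diagram) : Prop :=
  exists i0 i : 'I_(size (code D)),
    [/\ i0 = 0 :> nat,
        code D' = rot i (code D)
      & fconnect (@next_side (code D)) (i0, outer D) (i, outer D')].

(* A move inside a disk is given by the list of the strands of the disk, each
   one with its passages before and after the move.  Since the base point is
   taken outside the disk, each strand is a block of consecutive letters; the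
   strands may be visited in any order along the circle. *)

Definition template : Type := seq (word * word).

Definition replaced (t : template) (w w' : word) : Prop :=
  exists (r : template) (u0 : word) (us : seq word),
    [/\ perm_eq r t, size us = size r,
        w = u0 ++ flatten [seq x.1.1 ++ x.2 | x <- zip r us]
      & w' = u0 ++ flatten [seq x.1.2 ++ x.2 | x <- zip r us]].

(* The move or its inverse.  Both words being planar, the blocks do bound a
   disk: the regions enclosed by the blocks in the templates below are orbits
   of [next_side] that use no edge side outside the blocks. *)
Definition local_move (T : template -> Prop) (D D' : diagram) : Prop :=
  outer D' = outer D /\
  exists2 t, T t & replaced t (code D) (code D') \/ replaced t (code D') (code D).

Definition orient (e : bool) (s : word) : word := if e then s else rev s.

(* Real or virtual according to the kind of [a]. *)
Definition reidemeister1 (t : template) : Prop :=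
  exists (a : crossing) (f : bool), t = [:: ([::], [:: (a, f); (a, ~~ f)])].

(* Either both crossings are virtual, or they are real of opposite signs,
   which means that the same strand is over at both.  The two strands run
   around the bigon in the same direction if [e], in opposite directions
   otherwise. *)
Definition reidemeister2 (t : template) : Prop :=
  exists (a b : crossing) (e f : bool),
    kind b = omap negb (kind a) /\
    t = [:: ([::], [:: (a, f); (b, ~~ f)]);
            ([::], orient e [:: (a, ~~ f); (b, f)])].

(* Three strands whose crossings [a], [b], [c] are the vertices of a triangle
   in counterclockwise order.  They carry the sides ab, bc and ca of the
   triangle, in this direction for those with [ei = true] and in the opposite
   direction for the others. *)
Definition triangle (e1 e2 e3 : bool) (a b c : crossing) : seq word :=
  [:: orient e1 [:: (a, e3 != e1); (b, e1 == e2)];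
      orient e2 [:: (b, e1 != e2); (c, e2 == e3)];
      orient e3 [:: (c, e2 != e3); (a, e3 == e1)]].

(* The strand is over at one of its two crossings and under at the other (for
   a strand with two real crossings). *)
Definition alternating (s : word) : bool := count is_over s == 1.

(* All crossings virtual; or one real crossing, and the third strand has two
   virtual crossings; or all crossings real, with a top, a middle and a bottom
   strand. *)
Definition reidemeister3 (t : template) : Prop :=
  exists (e1 e2 e3 : bool) (a b c : crossing),
    let s := triangle e1 e2 e3 a b c in
    (count is_real [:: a; b; c] <= 1 \/
     all is_real [:: a; b; c] /\ ~~ all alternating s) /\
    t = [seq (x, rev x) | x <- s].

Definition reidemeister (t : template) : Prop :=
  [\/ reidemeister1 t, reidemeister2 t | reidemeister3 t].

Definition elementary (D D' : diagram) : Prop :=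
  [\/ renaming D D', rebasing D D' | local_move reidemeister D D'].

Definition equivalent : diagram -> diagram -> Prop :=
  clos_refl_sym_trans diagram elementary.

Inductive vmove := VDeltaWedge | VDeltaCirc | VSharp | VPass.

Definition vdelta (coherent : bool) (t : template) : Prop :=
  exists (e1 e2 e3 : bool) (a b c a' b' c' : crossing),
    let s := triangle e1 e2 e3 a b c in
    [/\ ((e1 == e2) && (e2 == e3)) = coherent,
        all is_real [:: a; b; c], all alternating s,
        all is_virtual [:: a'; b'; c']
      & t = zip s (triangle e1 e2 e3 a' b' c')].

(* Two horizontal strands followed by two vertical ones: the lower and the
   upper horizontal strands run eastwards if [p1], resp. [p2]; the left and the
   right vertical strands run northwards if [q1], resp. [q2].  The crossings
   are [a], [b] (lower left, lower right), [c], [d] (upper left, upper right). *)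
Definition horizontals (p1 p2 q1 q2 : bool) (a b c d : crossing) : seq word :=
  [:: orient p1 [:: (a, p1 == q1); (b, p1 == q2)];
      orient p2 [:: (c, p2 == q1); (d, p2 == q2)]].

Definition verticals (p1 p2 q1 q2 : bool) (a b c d : crossing) : seq word :=
  [:: orient q1 [:: (a, p1 != q1); (c, p2 != q1)];
      orient q2 [:: (b, p1 != q2); (d, p2 != q2)]].

Definition grid (p1 p2 q1 q2 : bool) (a b c d : crossing) : seq word :=
  horizontals p1 p2 q1 q2 a b c d ++ verticals p1 p2 q1 q2 a b c d.

Definition vgrid (parallel : bool) (t : template) : Prop :=
  exists (p1 p2 q1 q2 : bool) (a b c d a' b' c' d' : crossing),
    [/\ (p1 == p2) = parallel /\ (q1 == q2) = parallel,
        all is_real [:: a; b; c; d],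
        all (all is_over) (horizontals p1 p2 q1 q2 a b c d),
        all is_virtual [:: a'; b'; c'; d']
      & t = zip (grid p1 p2 q1 q2 a b c d) (grid p1 p2 q1 q2 a' b' c' d')].

Definition vmove_template (X : vmove) : template -> Prop :=
  match X with
  | VDeltaWedge => vdelta false
  | VDeltaCirc => vdelta true
  | VSharp => vgrid true
  | VPass => vgrid false
  end.

Local Open Scope classical_set_scope.

Definition knot_of (D : diagram) : set diagram := [set D' | equivalent D D'].
Definition virtual_knot : set (set diagram) := range knot_of.

Definition circle : diagram := @Diagram [::] true isT isT.
Definition trivial_knot : set diagram := knot_of circle.

(* [D] is deformed into [D'] with exactly [n] [X]-moves. *)
Inductive deforms (X : vmove) : nat -> diagram -> diagram -> Prop :=
| deforms0 D D' of equivalent D D' : deforms X 0 D D'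
| deformsS n D D1 D2 D' of deforms X n D D1
    & local_move (vmove_template X) D1 D2 & equivalent D2 D' :
    deforms X n.+1 D D'.

Definition unknottable_in (X : vmove) (K : set diagram) (n : nat) : Prop :=
  exists D D', [/\ K D, trivial_knot D' & deforms X n D D'].

Definition unknotting_number_is (X : vmove) (K : set diagram) (m : nat) : Prop :=
  unknottable_in X K m /\ forall n, unknottable_in X K n -> m <= n.

(* Main.v *)
(* The lower bound comes from index-weighted writhes: the sum of sign(c) g(ind c)
   over the real crossings c is an invariant as soon as g(0) = 0.  Each strand of
   the four moves loses an even total weight, so the parity of the index of every
   crossing outside the disk is unchanged, and the odd writhe changes by at most 2
   (by 4 for the sharp move).  Near the base point of any planar word one can
   insert a block of crossings that a single move turns into something removable by
   Reidemeister moves I and II, and that contributes exactly 2 (resp. 4) to the odd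
   writhe.  Stacking m blocks gives unknotting number m; a chain of nested kinks in
   the last block makes some indices grow with a parameter, and the writhe
   weighted by the square of the index tells the resulting knots apart. *)
Require Import Defs.
From mathcomp Require Import all_boot all_order all_algebra.
From mathcomp Require Import zify ring.
From mathcomp Require Import boolp classical_sets cardinality.
From Stdlib Require Import Relation_Operators.
Set Implicit Arguments. Unset Strict Implicit. Unset Printing Implicit Defensive.
Import Order.TTheory GRing.Theory Num.Theory.

(** * Lists of faces certify planarity *)

(** Planarity is part of a diagram, and the words used here have unbounded length, so it cannot be
    settled by evaluation: every word carries an explicit list of its regions, updated at each
    insertion. The shape of the blocks answers three demands. Two edges can be clasped by a planar
    Reidemeister II insertion only if they lie on a common region; they must be far apart in
    accumulated weight, since this distance is, up to a constant, the index of the crossings between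
    them; and the distance must disappear once the clasp is undone. In a chain of nested kinks
    turning alternately to either side, weights add up on the way in and cancel on the way out,
    while the centre stays on one region with the outermost edge. Indices take values in an
    arbitrary commutative ring so that one invariance proof serves twice: over ['F_2], with the
    indicator of 1, to count moves, and over the integers, with squares, to separate knots. *)

Lemma other_neq p : (other p == p) = false.
Proof. by case: p => c [] /=; apply/eqP => -[]. Qed.

Lemma otherK : involutive other.
Proof. by case=> c []. Qed.

(* [(p, true)] is the left side of the edge that ends at [p], [(p, false)] its
   right side; [turn] is [next_side] in these coordinates, which do not depend on
   the base point. *)
Definition dart : Type := (passage * bool)%type.

Definition turn (w : word) (d : dart) : dart :=
  let k := if d.2 then d.1 else prev w d.1 in
  if k.2 == d.2 then (next w (other k), true) else (other k, false).

Definition darts (w : word) : seq dart :=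
  flatten [seq [:: (p, true); (p, false)] | p <- w].

(** A partition of the darts into [turn]-cycles, as many as Euler's formula asks for. Empty lists
    are excluded: they are cycles vacuously and would falsify the count. *)
Definition is_faces (w : word) (fs : seq (seq dart)) : Prop :=
  [/\ perm_eq (flatten fs) (darts w), all (fcycle (turn w)) fs,
      [::] \notin fs & size fs = (size w)./2 + 2].

Lemma mem_darts w d : (d \in darts w) = (d.1 \in w).
Proof.
case: d => q b /=; elim: w => [|p w IH] //=; rewrite !inE IH !xpair_eqE.
by case: {IH} b; rewrite ?andbT ?andbF ?orbF.
Qed.

Lemma uniq_darts w : uniq w -> uniq (darts w).
Proof.
elim: w => [|p w IH] //= /andP[pw uw].
by rewrite /= inE -!/(darts w) !mem_darts /= (negbTE pw) xpair_eqE andbF IH.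
Qed.

Lemma next_nthmod (T : eqType) (x0 : T) (w : seq T) i : uniq w -> i < size w ->
  next w (nth x0 w i) = nth x0 w (i.+1 %% size w).
Proof.
move=> uw iw; rewrite next_nth mem_nth //.
case: w uw iw => // y w uw iw; rewrite index_uniq //=.
case: (ltngtP i (size w)) => h; last 1 first.
- by rewrite h modnn /= nth_default.
- by rewrite modn_small ?ltnS //= (set_nth_default x0).
- by move: iw h; rewrite /= ltnS leqNgt => /negbTE ->.
Qed.

Lemma prev_nthmod (T : eqType) (x0 : T) (w : seq T) i : uniq w -> i < size w ->
  prev w (nth x0 w i) = nth x0 w ((i + size w).-1 %% size w).
Proof.
move=> uw iw; have s0 : 0 < size w by apply: leq_ltn_trans iw.
have -> : nth x0 w i = next w (nth x0 w ((i + size w).-1 %% size w)).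
  rewrite next_nthmod ?ltn_mod //; congr nth.
  rewrite -addn1 modnDml addn1 prednK ?modnDr ?modn_small //.
  by rewrite addn_gt0 s0 orbT.
by rewrite prev_next.
Qed.

Lemma same_face_inj fs (F G : seq dart) d : uniq (flatten fs) -> F \in fs -> G \in fs ->
  d \in F -> d \in G -> F = G.
Proof.
elim: fs => //= H fs IH; rewrite cat_uniq => /and3P[_ /hasPn dis ufs].
rewrite !inE => /orP[/eqP->|FF] /orP[/eqP->|GG] dF dG //; last exact: IH.
- have /dis /= : d \in flatten fs by apply/flattenP; exists G.
  by rewrite dF.
- have /dis /= : d \in flatten fs by apply/flattenP; exists F.
  by rewrite dG.
Qed.

Lemma uniq_flatten_mem fs (F : seq dart) : uniq (flatten fs) -> F \in fs -> uniq F.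
Proof.
elim: fs => //= H fs IH; rewrite cat_uniq => /and3P[uH _ ufs].
by rewrite inE => /orP[/eqP->|] //; apply: IH.
Qed.

Lemma faces_cover w fs d : is_faces w fs -> d.1 \in w ->
  exists F, [/\ F \in fs, d \in F & turn w d \in F].
Proof.
case=> pe cy _ _; rewrite -mem_darts -(perm_mem pe) => /flattenP[F Ff dF].
exists F; split=> //; have /allP /(_ _ Ff) cF := cy.
by move: (next_cycle cF dF) => /eqP ->; rewrite mem_next.
Qed.

Lemma uniq_flattenW (fs : seq (seq dart)) : uniq (flatten fs) -> [::] \notin fs -> uniq fs.
Proof.
elim: fs => //= -[|d H] fs IH; first by rewrite inE.
rewrite cat_uniq !inE => /and3P[_ /hasPn dis ufs] nz; rewrite IH // andbT.
apply/negP => Hf; have /dis : d \in flatten fs.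
  by apply/flattenP; exists (d :: H); rewrite ?mem_head.
by rewrite inE eqxx.
Qed.

Section Count.
Variables (w : word) (fs : seq (seq dart)).
Hypotheses (wfw : wf_word w) (fsw : is_faces w fs).

Let uw : uniq w. Proof. by case/andP: wfw. Qed.
Let phi (d : edge_side w) : dart := (tnth (in_tuple w) d.1, d.2).

Let phiE d : phi d = (nth ((0, None), true) w d.1, d.2).
Proof. by rewrite /phi (tnth_nth ((0, None), true)). Qed.

Let phi_inj : injective phi.
Proof.
case=> i s [j t]; rewrite !phiE /= => -[/eqP e ->].
by move: e; rewrite nth_uniq // => /eqP /val_inj ->.
Qed.

Let phi_next d : phi (next_side d) = turn w (phi d).
Proof.
case: d => i s; rewrite /next_side /turn [phi (i, s)]phiE /=.
set x0 := ((0, None), true).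
have prd : prev w (nth x0 w i) = nth x0 w (ord_pred i) by rewrite prev_nthmod.
set k := if s then i else ord_pred i.
have -> : (if s then nth x0 w i else prev w (nth x0 w i)) = nth x0 w k.
  by rewrite prd /k; case: ifP.
have part (j : 'I_(size w)) : nth x0 w (partner j) = other (nth x0 w j).
  have ow : other (nth x0 w j) \in w.
    by have /andP[_ /allP] := wfw; apply; apply: mem_nth.
  rewrite /partner (tnth_nth x0) /= insubdK ?nth_index //.
  by rewrite -topredE /= index_mem.
rewrite (tnth_nth x0) /=; case: ifP => _; rewrite phiE /=; last by rewrite part.
by rewrite -/x0 -next_nthmod // part.
Qed.

Let phi_in d : (phi d).1 \in w.
Proof. by rewrite phiE; apply: mem_nth. Qed.

Let phi_surj (d : dart) : d.1 \in w -> {x | phi x = d}.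
Proof.
case: d => p s /= pw; have iw : index p w < size w by rewrite index_mem.
by exists (Ordinal iw, s); rewrite phiE /= nth_index.
Qed.

Let ufs : uniq (flatten fs).
Proof. by case: fsw => pe _ _ _; rewrite (perm_uniq pe) uniq_darts. Qed.

(** The certificate itself gives injectivity: on a listed cycle [turn] acts as [next], whose inverse
    is [prev], and distinct cycles share no dart. *)
Let next_inj : injective (@next_side w).
Proof.
move=> x y /(congr1 phi); rewrite !phi_next => e; apply: phi_inj.
have [F [Ff xF txF]] := faces_cover fsw (phi_in x).
have [G [Gf yG tyG]] := faces_cover fsw (phi_in y).
have FG : F = G by apply: (same_face_inj ufs Ff Gf txF); rewrite e.
have cF : fcycle (turn w) F by case: fsw => _ /allP /(_ _ Ff).
have uF : uniq F by apply: uniq_flatten_mem Ff.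
have nx d : d \in F -> turn w d = next F d.
  by move=> dF; move: (next_cycle cF dF) => /eqP.
rewrite -FG in yG; rewrite !nx // in e.
by rewrite -(prev_next uF (phi x)) e prev_next.
Qed.

Let iter_phi k x : phi (iter k (@next_side w) x) = iter k (turn w) (phi x).
Proof. by elim: k => //= k <-; rewrite phi_next. Qed.

Let same_connect F x y : F \in fs -> phi x \in F ->
  fconnect (@next_side w) x y = (phi y \in F).
Proof.
move=> Ff xF; have cF : fcycle (turn w) F by case: fsw => _ /allP /(_ _ Ff).
apply/idP/idP.
  move=> /iter_findex <-; elim: findex => //= k IH.
  by rewrite phi_next; move: (next_cycle cF IH) => /eqP ->; rewrite mem_next.
have [i s rs] := rot_to xF; rewrite -(mem_rot i) rs => yF.
move: cF; rewrite -(rot_cycle i) rs /= rcons_path => /andP[/fpathP[n sE] _].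
move: yF; rewrite inE => /orP[/eqP /phi_inj -> //|].
rewrite sE => /trajectP[k _]; rewrite -iterSr -iter_phi => /phi_inj ->.
exact: fconnect_iter.
Qed.

(** Read through the injection [phi] of edge sides into darts, each listed cycle is exactly one
    orbit of [next_side]; taking the root of a point of each cycle puts the list in bijection with
    the orbits. *)
Lemma faces_planar : planar w.
Proof.
case: (fsw) => pe cy nz sz; apply/orP; right; rewrite -sz.
have hd (i : 'I_(size fs)) : {x | phi x \in nth [::] fs i}.
  have Ff : nth [::] fs i \in fs by apply: mem_nth.
  case E : (nth [::] fs i) => [|d F]; first by move: nz; rewrite -E Ff.
  have dw : d.1 \in w.
    by rewrite -mem_darts -(perm_mem pe); apply/flattenP; exists (d :: F);
    rewrite -?E ?mem_head // E mem_head.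
  by have [x xd] := phi_surj dw; exists x; rewrite xd mem_head.
pose h i := froot (@next_side w) (sval (hd i)).
have sym := fconnect_sym next_inj.
have h_in i : phi (h i) \in nth [::] fs i.
  rewrite -(same_connect _ (mem_nth _ (ltn_ord i)) (svalP (hd i))).
  exact: connect_root.
have h_inj : injective h.
  move=> i j e; apply: val_inj; apply/eqP.
  have uf := uniq_flattenW ufs nz.
  rewrite -(nth_uniq [::] (ltn_ord i) (ltn_ord j) uf); apply/eqP.
  apply: (same_face_inj ufs (mem_nth _ (ltn_ord i)) (mem_nth _ (ltn_ord j)) (h_in i)).
  by rewrite e.
rewrite -(card_ord (size fs)) -(card_codom h_inj); apply/eqP/eq_card => x.
rewrite !inE andbT; apply/idP/idP.
  move=> rx; have [F [Ff xF _]] := faces_cover fsw (phi_in x).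
  apply/codomP; have iF : index F fs < size fs by rewrite index_mem.
  exists (Ordinal iF); rewrite -(eqP rx); apply/eqP.
  rewrite /h root_connect // sym (same_connect _ Ff) //.
  by case: (hd (Ordinal iF)) => y; rewrite /= nth_index.
by case/codomP=> i ->; apply: roots_root.
Qed.
End Count.

Lemma turn_rot i w : uniq w -> turn (rot i w) =1 turn w.
Proof. by move=> uw d; rewrite /turn next_rot ?prev_rot. Qed.

Lemma faces_rot i w fs : uniq w -> is_faces w fs -> is_faces (rot i w) fs.
Proof.
move=> uw [pe cy nz sz]; split=> //; last by rewrite size_rot.
- apply: perm_trans pe _; apply/perm_flatten/perm_map.
  by rewrite perm_sym perm_rot.
- by rewrite (eq_all (a2 := fcycle (turn w))) // => F; apply: eq_fcycle; apply: turn_rot.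
Qed.

(** * Effect of inserted crossings on the regions *)

Lemma next_cons (T : eqType) (p : T) t : next (p :: t) p = head p t.
Proof. by rewrite next_nth mem_head /= eqxx nth0. Qed.

Lemma next_cat (T : eqType) (u v : seq T) p q :
  uniq (u ++ p :: q :: v) -> next (u ++ p :: q :: v) p = q.
Proof. by move=> h; rewrite -(next_rot (size u)) // rot_size_cat next_cons. Qed.

Lemma prev_cat (T : eqType) (u v : seq T) p q :
  uniq (u ++ p :: q :: v) -> prev (u ++ p :: q :: v) q = p.
Proof. by move=> h; rewrite -{2}(next_cat h) prev_next. Qed.

Section Insertion.
Variables (w : word) (ins : passage -> word).
(* The letters [ins p] are inserted just before [p], which cuts the edge ending at
   [p] into pieces.  A walk along the old side [d] enters its first piece
   [start_dart d] and leaves its last piece [end_dart d]; in between it makes the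
   detour [sub d] around the new crossings. *)
Definition insert_at (w : word) : word := flatten [seq rcons (ins p) p | p <- w].
Definition first p := head p (ins p).
Definition start_dart (d : dart) : dart := if d.2 then (first d.1, true) else d.
Definition end_dart (d : dart) : dart := if d.2 then d else (first d.1, false).
Let w' := insert_at w.
Hypotheses (wfw : wf_word w) (uw' : uniq w').
Let uw : uniq w. Proof. by case/andP: wfw. Qed.

Lemma next_insert p : p \in w -> next w' p = first (next w p).
Proof.
move=> pw; have [i s rs] := rot_to pw.
have -> : next w p = head p s by rewrite -(next_rot i uw) rs next_cons.
pose u := insert_at (take i w); pose v := insert_at (drop i w).
have wE : w' = u ++ v.
  by rewrite /w' /insert_at -{1}(cat_take_drop i w) map_cat flatten_cat.
have vu : v ++ u = ins p ++ p :: insert_at s.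
  by rewrite /u /v /insert_at -flatten_cat -map_cat -[_ ++ _]/(rot i w) rs /= cat_rcons.
have uvu : uniq (v ++ u) by rewrite uniq_catC -wE.
rewrite -(next_rot (size u) uw') wE rot_size_cat.
rewrite -(next_rot (size (ins p)) uvu) vu rot_size_cat next_cons /first.
by case: s {rs vu} => [|q s]; rewrite /insert_at /= ?cat0s //; case: (ins q).
Qed.

Lemma prev_insert p : p \in w -> prev w' (first p) = prev w p.
Proof.
move=> pw; have pp : prev w p \in w by rewrite mem_prev.
by rewrite -{1}(next_prev uw p) -next_insert // prev_next.
Qed.

(** New letters subdivide edges and leave the old crossings alone, so a turn at an old crossing
    leads from the last piece of one side to the first piece of the next. An old region survives
    once each of its sides is replaced by its detour. *)
Lemma turn_insert d : d.1 \in w -> turn w' (end_dart d) = start_dart (turn w d).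
Proof.
have cl p : p \in w -> other p \in w by have /andP[_ /allP] := wfw; apply.
case: d => p [] /= pw; rewrite /turn /=.
  by case: ifP => _; rewrite /start_dart //= next_insert ?cl.
rewrite prev_insert //; set k := prev w p; have kw : k \in w by rewrite mem_prev.
by case: ifP => _; rewrite /start_dart //= next_insert ?cl.
Qed.

Variable sub : dart -> seq dart.
Definition good_sub d := exists t, [/\ sub d = start_dart d :: t,
  fpath (turn w') (start_dart d) t & last (start_dart d) t = end_dart d].

Lemma path_sub d F : d.1 \in w -> fpath (turn w) d F ->
    (forall x, x \in F -> good_sub x) ->
  fpath (turn w') (end_dart d) (flatten (map sub F)) /\
  last (end_dart d) (flatten (map sub F)) = end_dart (last d F).
Proof.
elim: F d => [|x F IH] d dw //= /andP[/eqP dx pF] gF.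
have xw : x.1 \in w.
  rewrite -dx /turn; have cl p : p \in w -> other p \in w by have /andP[_ /allP] := wfw; apply.
  by case: ifP => _ /=; rewrite ?mem_next cl //; case: ifP; rewrite ?mem_prev.
have [|t [-> pt lt]] := gF x; first exact: mem_head.
have [|p2 l2] := IH x xw pF; first by move=> y yF; apply: gF; rewrite inE yF orbT.
by rewrite /= turn_insert // dx eqxx cat_path pt last_cat lt.
Qed.

Lemma cycle_sub F : fcycle (turn w) F -> (forall x, x \in F -> x.1 \in w) ->
  (forall x, x \in F -> good_sub x) -> fcycle (turn w') (flatten (map sub F)).
Proof.
case: F => [|d F] //= cF iF gF; move: cF; rewrite rcons_path => /andP[pF /eqP lF].
have [|t [-> pt lt]] := gF d; first exact: mem_head.
have [||p2 l2] := @path_sub d F _ pF.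
- exact: iF (mem_head _ _).
- by move=> y yF; apply: gF; rewrite inE yF orbT.
rewrite /= rcons_path cat_path last_cat pt lt p2 l2 /= turn_insert ?lF //.
by apply: iF; apply: mem_last.
Qed.
End Insertion.

(** Permutations of partly explicit lists reduce to counts of an arbitrary predicate [Q], hence to
    linear arithmetic. *)
Ltac perm_lia Q := do 4 rewrite ?count_cat /=; rewrite ?addn0 ?addnA;
  repeat match goal with
  | |- context [nat_of_bool (Q ?x)] => move: (nat_of_bool (Q x)) => ?
  | |- context [count Q ?s] => move: (count Q s) => ?
  end; clear; lia.

Lemma insert_at_id (ins : passage -> word) s :
  (forall p, p \in s -> ins p = [::]) -> insert_at ins s = s.
Proof.
elim: s => //= p s IH h; rewrite /insert_at /= h ?mem_head //= -/(insert_at ins s) IH //.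
by move=> q qs; apply: h; rewrite inE qs orbT.
Qed.

Lemma flatten_sub_id (sub : dart -> seq dart) s :
  (forall d, d \in s -> sub d = [:: d]) -> flatten (map sub s) = s.
Proof.
elim: s => //= p s IH h; rewrite h ?mem_head //= IH //.
by move=> q qs; apply: h; rewrite inE qs orbT.
Qed.

Lemma flatten_map_flatten (sub : dart -> seq dart) fs :
  flatten [seq flatten (map sub F) | F <- fs] = flatten (map sub (flatten fs)).
Proof. by elim: fs => //= F fs ->; rewrite map_cat flatten_cat. Qed.

Lemma turnTT w c : turn w ((c, true), true) = (next w (c, false), true).
Proof. by []. Qed.

Lemma turnFT w c : turn w ((c, false), true) = ((c, true), false).
Proof. by []. Qed.

Lemma turnTF w c p : prev w p = (c, true) -> turn w (p, false) = ((c, false), false).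
Proof. by rewrite /turn /= => ->. Qed.

Lemma turnFF w c p : prev w p = (c, false) -> turn w (p, false) = (next w (c, true), true).
Proof. by rewrite /turn /= => ->. Qed.

Lemma darts_cons p w : darts (p :: w) = [:: (p, true), (p, false) & darts w].
Proof. by []. Qed.

(* The region containing [(p0, ~~ f)] also lies along the outer side of the loop;
   keeping track of this allows later insertions between the loop and that region. *)
Lemma faces_R1 a f p0 s fs : let w := p0 :: s in
  let w' := (a, f) :: (a, ~~ f) :: w in
  wf_word w -> is_faces w fs -> uniq w' ->
  exists2 fs', is_faces w' fs' & forall F, F \in fs -> exists F',
    [/\ F' \in fs', {subset F <= F'} &
        ((p0, ~~ f) \in F -> ((a, ~~ f), f) \in F')].
Proof.
move=> w w' wfw [pe cy nz sz] uw'.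
pose ins p := if p == p0 then [:: (a, f); (a, ~~ f)] else [::].
have uw : uniq w by case/andP: wfw.
have p0s : p0 \notin s by case/andP: uw.
have w'E : insert_at ins w = w'.
  rewrite /insert_at /= -/(insert_at ins s) {1}/ins eqxx /= insert_at_id // => p ps.
  by rewrite /ins; case: eqP ps p0s => // -> ->.
have uiw : uniq (insert_at ins w) by rewrite w'E.
pose b1 : passage := (a, f); pose b2 : passage := (a, ~~ f).
(* The inside of the loop is the monogon [(b2, ~~ f)]. Its outer side [(b2, f)] falls to the region
   on the side [~~ f] of the edge; on the other side the walk merely passes the new crossing. *)
pose sub (d : dart) : seq dart := if d == (p0, true) then
    (if f then [:: (b1, true); (p0, true)] else [:: (b1, true); (b2, false); (p0, true)])
  else if d == (p0, false) then
    (if f then [:: (p0, false); (b2, true); (b1, false)] else [:: (p0, false); (b1, false)])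
  else [:: d].
have n1 : next w' b1 = b2 by apply: (@next_cat _ [::]).
have n2 : next w' b2 = p0 by apply: (@next_cat _ [:: b1]).
have v1 : prev w' b2 = b1 by apply: (@prev_cat _ [::]).
have v2 : prev w' p0 = b2 by apply: (@prev_cat _ [:: b1]).
have gsub d : good_sub w ins sub d.
  rewrite /good_sub w'E /sub; case: eqP => [->|d1].
    rewrite /start_dart /end_dart /first /ins /= eqxx /=.
    move: n1 n2 v1 v2; rewrite /b1 /b2; clear; move: w' => w'.
    by case: f => /= n1 n2 v1 v2; (eexists; split; first by reflexivity);
       rewrite //= ?turnTT ?turnFT ?(turnTF v1) ?(turnFF v1) ?(turnTF v2) ?(turnFF v2) ?n1 ?n2 ?eqxx.
  case: eqP => [->|d2].
    rewrite /start_dart /end_dart /first /ins /= eqxx /=.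
    move: n1 n2 v1 v2; rewrite /b1 /b2; clear; move: w' => w'.
    by case: f => /= n1 n2 v1 v2; (eexists; split; first by reflexivity);
       rewrite //= ?turnTT ?turnFT ?(turnTF v1) ?(turnFF v1) ?(turnTF v2) ?(turnFF v2) ?n1 ?n2 ?eqxx.
  have dp : d.1 != p0 by case: (d) d1 d2 => p [] /= d1 d2; apply/eqP => dp; rewrite dp in d1 d2.
  exists [::]; rewrite /start_dart /end_dart /first /ins (negbTE dp) /=.
  by case: (d) => p [].
have fsw F : F \in fs -> forall x, x \in F -> x.1 \in w.
  by move=> Ff x xF; rewrite -mem_darts -(perm_mem pe); apply/flattenP; exists F.
have dsub d : d \in sub d by rewrite /sub; do 2?case: eqP => [->|_]; case: (f); rewrite !inE eqxx ?orbT.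
exists ([:: (b2, ~~ f)] :: [seq flatten (map sub F) | F <- fs]); first split.
- rewrite /= flatten_map_flatten (perm_trans _ (y := (b2, ~~ f) :: flatten (map sub (darts w)))) //.
    by rewrite perm_cons; apply/perm_flatten/perm_map.
  rewrite !darts_cons /= -/(darts s) (flatten_sub_id (s := darts s)); last first.
    move=> d; rewrite mem_darts /sub => ds.
    by case: eqP ds p0s => [-> -> //|_]; case: eqP => [-> -> //|].
  rewrite /sub !eqxx xpair_eqE eqxx /= /b1 /b2; clear; apply/permP => Q.
  by case: (f); perm_lia Q.
- rewrite /= all_map; apply/andP; split; last first.
    apply/allP => F Ff /=; rewrite -w'E; apply: cycle_sub => //; last exact: fsw.
    by move/allP: cy => /(_ _ Ff).
  rewrite andbT; move: n1 n2 v1 v2; rewrite /b1 /b2; clear; move: w' => w'.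
  case: f => /= n1 n2 v1 v2;
       by rewrite //= ?turnTT ?turnFT ?(turnTF v1) ?(turnFF v1) ?(turnTF v2) ?(turnFF v2) ?n1 ?n2 ?eqxx.
- rewrite inE /=; apply/mapP => -[F Ff].
  by case: F Ff => [|d F] Ff; [rewrite Ff in nz|move: (dsub d) => /=; case: (sub d)].
- by rewrite /= size_map sz /=; lia.
move=> F Ff; exists (flatten (map sub F)); split.
- by rewrite inE; apply/orP; right; apply/mapP; exists F.
- by move=> d dF; apply/flattenP; exists (sub d); rewrite ?map_f.
move=> pF; apply/flattenP; exists (sub (p0, ~~ f)); first by apply/mapP; exists (p0, ~~ f).
by rewrite /sub /b2; case: (f); rewrite /= !xpair_eqE !eqxx /= !inE !eqxx ?orbT.
Qed.

Lemma is_faces_perm w fs gs : perm_eq fs gs -> is_faces w fs -> is_faces w gs.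
Proof.
move=> pe [pf cy nz sz]; split.
- by apply: perm_trans pf; rewrite perm_sym; apply: perm_flatten.
- by rewrite -(perm_all _ pe).
- by rewrite -(perm_mem pe).
- by rewrite -(perm_size pe).
Qed.

Lemma is_faces_rot1 w F fs i : is_faces w (F :: fs) -> is_faces w (rot i F :: fs).
Proof.
case=> pf /= /andP[cF cy] nz sz; split=> //=.
- by apply: perm_trans pf; rewrite /= perm_cat2r perm_rot.
- by rewrite rot_cycle cF.
- by move: nz; rewrite !inE ![[::] == _]eq_sym -!size_eq0 size_rot.
Qed.

Lemma flatten_sub_cat (sub : dart -> seq dart) s1 s2 :
  flatten (map sub (s1 ++ s2)) = flatten (map sub s1) ++ flatten (map sub s2).
Proof. by rewrite map_cat flatten_cat. Qed.

(* Pushing two edges with a common region [d1 :: F1 ++ d2 :: F2] over each other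
   creates a bigon and splits this region into two. *)
Section R2.
Variables (a b : crossing) (e f : bool) (q0 : passage) (v : word) (p0 : passage) (t : word).
Let b1 : passage := (a, f).
Let b2 : passage := (b, ~~ f).
Let c1 : passage := if e then (a, ~~ f) else (b, f).
Let c2 : passage := if e then (b, f) else (a, ~~ f).
Let s1 := f (+) e.
Let w : word := q0 :: v ++ p0 :: t.
Let w' : word := [:: b1, b2, q0 & v ++ [:: c1, c2, p0 & t]].
Let ins p := if p == q0 then [:: b1; b2] else if p == p0 then [:: c1; c2] else [::].
Let d1 := (q0, s1).
Let d2 := (p0, f).
Let sub (d : dart) : seq dart :=
  if d == (q0, ~~ s1) then [:: start_dart ins d; (c2, f); end_dart ins d]
  else if d == (p0, ~~ f) then [:: start_dart ins d; (b2, s1); end_dart ins d]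
  else [:: d].
Hypotheses (wfw : wf_word w) (uw' : uniq w').

Let uw : uniq w. Proof. by case/andP: wfw. Qed.
Let qp : (p0 == q0) = false.
Proof.
by apply/negbTE; move: uw => /= /andP[]; rewrite mem_cat inE !negb_or eq_sym => /and3P[].
Qed.
Let qv : q0 \notin v.
Proof. by move: uw => /= /andP[]; rewrite mem_cat !negb_or => /andP[]. Qed.
Let qt : q0 \notin t.
Proof. by move: uw => /= /andP[]; rewrite mem_cat inE !negb_or => /and3P[]. Qed.
Let pv : p0 \notin v.
Proof. by move: uw => /= /andP[_]; rewrite cat_uniq /= !negb_or => /and3P[_ /andP[]]. Qed.
Let pt : p0 \notin t.
Proof. by move: uw => /= /andP[_]; rewrite cat_uniq /= !negb_or => /and3P[_ _ /andP[]]. Qed.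

Let w'E : insert_at ins w = w'.
Proof.
have idv s : q0 \notin s -> p0 \notin s -> insert_at ins s = s.
  move=> qs ps; apply: insert_at_id => p sp; rewrite /ins.
  by case: eqP sp qs => [-> ->//|_]; case: eqP ps => [-> /negbTE -> //|].
rewrite /insert_at /w /= map_cat flatten_cat /= -!/(insert_at ins _) !idv //.
by rewrite /ins eqxx qp eqxx.
Qed.

Let next_facts : [/\ next w' b1 = b2, next w' b2 = q0, next w' c1 = c2 & next w' c2 = p0].
Proof.
split; first exact: (@next_cat _ [::]); first exact: (@next_cat _ [:: b1]).
- by apply: (@next_cat _ [:: b1, b2, q0 & v]).
have := @next_cat _ [:: b1, b2, q0 & rcons v c1] t c2 p0.
by rewrite /= cat_rcons; apply.
Qed.

Let prev_facts : [/\ prev w' b2 = b1, prev w' q0 = b2, prev w' c2 = c1 & prev w' p0 = c2].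
Proof.
by case: next_facts => h1 h2 h3 h4; split; rewrite -?h1 -?h2 -?h3 -?h4 prev_next.
Qed.

Let local_turns : [/\ turn w' (start_dart ins d1) = end_dart ins d2,
   turn w' (start_dart ins d2) = end_dart ins d1,
   fcycle (turn w') [:: (b2, ~~ s1); (c2, ~~ f)],
   good_sub w ins sub (q0, ~~ s1) & good_sub w ins sub (p0, ~~ f)].
Proof.
rewrite /good_sub w'E /sub /start_dart /end_dart /first /d1 /d2 /ins /= ?xpair_eqE ?eqxx ?qp /=.

case: next_facts prev_facts => n1 n2 n3 n4 [v1 v2 v3 v4].
move: n1 n2 n3 n4 v1 v2 v3 v4; rewrite /b1 /b2 /c1 /c2 /s1; clear.
move: w' => w0; case: f; case: e => /= n1 n2 n3 n4 v1 v2 v3 v4;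
split; try (eexists; split; first by reflexivity);
by rewrite //= ?turnTT ?turnFT ?(turnTF v1) ?(turnFF v1) ?(turnTF v2) ?(turnFF v2)
 ?(turnTF v3) ?(turnFF v3) ?(turnTF v4) ?(turnFF v4) ?n1 ?n2 ?n3 ?n4 ?eqxx.
Qed.

Let good_other d : d != d1 -> d != d2 -> good_sub w ins sub d.
Proof.
move=> n1 n2; case: local_turns => _ _ _ g1 g2.
have [->//|m1] := eqVneq d (q0, ~~ s1); have [->//|m2] := eqVneq d (p0, ~~ f).
exists [::]; rewrite /sub (negbTE m1) (negbTE m2).
have dq : d.1 != q0.
  apply: contraNneq n1; move: m1; rewrite /d1; case: (d) => p s /= m1 pq; move: m1.
  by rewrite pq !xpair_eqE eqxx /=; case: (s); case: (s1).
have dp : d.1 != p0.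
  apply: contraNneq n2; move: m2; rewrite /d2; case: (d) => p s /= m2 pq; move: m2.
  by rewrite pq !xpair_eqE eqxx /=; case: (s); case: (f).
rewrite /start_dart /end_dart /first /ins (negbTE dq) (negbTE dp) /=.
by case: (d) => p [].
Qed.

Lemma faces_R2 fs F : is_faces w fs -> F \in fs -> d1 \in F -> d2 \in F ->
  exists fs', is_faces w' fs'.
Proof.
move=> fsw Ff d1F d2F.
have [F1 [F2 [fs0 fE]]] : exists F1 F2 fs0, is_faces w ((d1 :: F1 ++ d2 :: F2) :: fs0).
  have := is_faces_perm (perm_to_rem Ff) fsw.
  have [i s rs] := rot_to d1F => /(is_faces_rot1 i); rewrite rs => h.
  have : d2 \in d1 :: s by rewrite -rs mem_rot.
  rewrite inE /d1 /d2 xpair_eqE qp /= => d2s.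
  by case/splitPr: d2s h => F1 F2 h; exists F1, F2, (rem F fs).
case: fE => pe /= /andP[cF cy] nz sz.
have [t1 t2 bigon g1 g2] := local_turns.
have uF : uniq (d1 :: F1 ++ d2 :: F2 ++ flatten fs0).
  rewrite (_ : _ :: _ = flatten ((d1 :: F1 ++ d2 :: F2) :: fs0)); last by rewrite /= -catA.
  by rewrite (perm_uniq pe) uniq_darts.
have out d : d \in F1 ++ F2 ++ flatten fs0 -> d != d1 /\ d != d2.
  move=> dF; move: uF; rewrite (perm_uniq (_ : perm_eq _ (d1 :: d2 :: F1 ++ F2 ++ flatten fs0))).
    rewrite /= inE negb_or => /and3P[/andP[_ n1] n2 _].
    by split; [apply: contraNneq n1 => <-|apply: contraNneq n2 => <-].
  by rewrite perm_cons -cat1s perm_catCA.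
have good d : d \in F1 ++ F2 ++ flatten fs0 -> good_sub w ins sub d.
  by move=> /out[]; apply: good_other.
have dw d : d \in F1 ++ F2 ++ flatten fs0 -> d.1 \in w.
  move=> dF; rewrite -mem_darts -(perm_mem pe) /=; move: dF.
  by rewrite inE !mem_cat !inE => /or3P[]->; rewrite ?orbT.
have uiw : uniq (insert_at ins w) by rewrite w'E.
have d1w : d1.1 \in w by rewrite mem_head.
have d2w : d2.1 \in w by rewrite /w /= inE mem_cat inE eqxx !orbT.
have [pF1 pF2 l1 l2] : [/\ fpath (turn w) d1 F1, fpath (turn w) d2 F2,
    turn w (last d1 F1) = d2 & turn w (last d2 F2) = d1].
  move: cF; rewrite rcons_cat cat_path /= rcons_path.
  by case/and4P => -> /eqP -> -> /eqP ->.
have [|pp1 ll1] := @path_sub w ins wfw uiw sub d1 F1 d1w pF1.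
  by move=> x xF; apply: good; rewrite mem_cat xF.
have [|pp2 ll2] := @path_sub w ins wfw uiw sub d2 F2 d2w pF2.
  by move=> x xF; apply: good; rewrite !mem_cat xF orbT.
rewrite w'E in pp1 pp2.
have turnE d : d.1 \in w -> turn w' (end_dart ins d) = start_dart ins (turn w d).
  by move=> h; rewrite -w'E turn_insert.
(* The bigon, the two halves of the split region, and the remaining regions with their detours: two
   more regions for two more crossings. At the clasp the walk along [d1] switches to the end of
   [d2], so each half keeps one of [F1], [F2]. *)
exists [:: [:: (b2, ~~ s1); (c2, ~~ f)],
  [:: start_dart ins d1, end_dart ins d2 & flatten (map sub F2)],
  [:: start_dart ins d2, end_dart ins d1 & flatten (map sub F1)]
  & [seq flatten (map sub G) | G <- fs0]].
split.
- rewrite /= flatten_map_flatten.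
  have pe2 : perm_eq (F1 ++ F2 ++ flatten fs0)
      [:: (q0, ~~ s1), (p0, ~~ f) & darts v ++ darts t].
    rewrite -(perm_cat2l [:: d1; d2]); apply: perm_trans (_ : perm_eq _ (darts w)) _.
      apply: perm_trans pe; rewrite /= perm_cons -catA /= -cat1s perm_sym -[_ :: _ ++ _]cat1s.
      by rewrite perm_catCA.
    rewrite /w /darts /= map_cat flatten_cat /= -!/(darts _); apply/permP => Q.
    by rewrite /d1 /d2; case: (s1); case: (f); perm_lia Q.
  have := perm_flatten (perm_map sub pe2); rewrite /= !flatten_sub_cat.
  have idv s : q0 \notin s -> p0 \notin s -> flatten (map sub (darts s)) = darts s.
    move=> qs ps; apply: flatten_sub_id => d; rewrite mem_darts /sub => ds.
    by case: eqP ds qs => [-> /= ->//|_]; case: eqP ps => [-> /= /negbTE -> //|].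
  rewrite !idv //.
  rewrite /sub !eqxx xpair_eqE qp /= -/sub => /permP pQ; apply/permP => Q.
  move: (pQ Q); rewrite /w' /darts /= map_cat flatten_cat /= -!/(darts _).
  rewrite /start_dart /end_dart /first /ins !eqxx qp /d1 /d2 /b1 /b2 /c1 /c2 /s1.
  by case: (f); case: (e); perm_lia Q.
- apply/and4P; split; first exact: bigon.
  - rewrite /= rcons_path t1 eqxx pp2 ll2 /= turnE ?l2 //.
    have := mem_last d2 F2; rewrite inE => /orP[/eqP->//|h].
    by apply: dw; rewrite !mem_cat h orbT.
  - rewrite /= rcons_path t2 eqxx pp1 ll1 /= turnE ?l1 //.
    have := mem_last d1 F1; rewrite inE => /orP[/eqP->//|h].
    by apply: dw; rewrite !mem_cat h.
  rewrite -/(all _ _) all_map; apply/allP => G Gf /=; rewrite -w'E.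
  have Gfl x : x \in G -> x \in F1 ++ F2 ++ flatten fs0.
    by move=> xG; rewrite !mem_cat; apply/or3P/Or33/flattenP; exists G.
  apply: cycle_sub => //; first by move/allP: cy => /(_ _ Gf).
    by move=> x /Gfl /dw.
  by move=> x /Gfl /good.
- rewrite !inE /=; apply/mapP => -[[|d G] Gf].
    by move: nz; rewrite inE Gf orbT.
  have : d \in F1 ++ F2 ++ flatten fs0.
    by rewrite !mem_cat; apply/or3P/Or33/flattenP; exists (d :: G); rewrite ?mem_head.
  by move/good => [r [/= -> _ _]].
- have -> : size w' = (size w).+4 by rewrite /w' /w /= !size_cat /= !addnS.
  by case: sz => sz; rewrite [LHS]/= size_map sz /= !addSn.
Qed.
End R2.

(** * Words and their diagrams *)

Lemma wf_perm w w' : perm_eq w w' -> wf_word w = wf_word w'.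
Proof.
move=> pe; rewrite /wf_word (perm_uniq pe) (perm_all _ pe); congr andb.
by apply: eq_all => p; rewrite (perm_mem pe).
Qed.

Lemma mem_fst p w : p.1 \in map fst w -> p \in w \/ other p \in w.
Proof.
case: p => c s /mapP[[d r] qw /= ->]; rewrite /other /=.
have [->|rs] := eqVneq s r; [by left|right].
by have -> : ~~ s = r by case: (s) (r) rs => -[].
Qed.

Lemma wf_pair p w :
  wf_word [:: p, other p & w] = wf_word w && (p.1 \notin map fst w).
Proof.
rewrite /wf_word /= !inE !otherK !eqxx orbT /= eq_sym other_neq /=.
apply/idP/idP.
  case/andP=> /and3P[pw opw uw] /allP cl; rewrite uw /=.
  have -> /= : p.1 \notin map fst w.
    by apply/negP => /mem_fst[] h; [rewrite h in pw|rewrite h in opw].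
  rewrite andbT; apply/allP => q qw; move: (cl q qw); rewrite !inE.
  case/or3P=> // /eqP e; first by rewrite -e otherK qw in opw.
  by rewrite -[p]otherK -e otherK qw in pw.
case/andP=> /andP[-> cl] pw; rewrite !andbT.
have npw q : q.1 = p.1 -> q \notin w by move=> e; apply: contra pw => qw; rewrite -e map_f.
rewrite !npw //=; apply/allP => q qw; rewrite !inE.
by move/allP: cl => /(_ q qw) ->; rewrite !orbT.
Qed.

Lemma wf_pairP w p w' : perm_eq w [:: p, other p & w'] ->
  wf_word w -> wf_word w' /\ p.1 \notin map fst w'.
Proof. by move=> /wf_perm ->; rewrite wf_pair => /andP. Qed.

(** The crossingless circle has no certificate: its word has no darts, yet two non-empty faces would
    be required. Hence the separate case. *)
Definition drawn (w : word) : Prop :=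
  wf_word w /\ (w = [::] \/ exists fs, is_faces w fs).

Lemma drawn_wf w : drawn w -> wf_word w.
Proof. by case. Qed.

Lemma drawn_planar w : drawn w -> planar w.
Proof. by case=> wfw [-> //|[fs h]]; apply: faces_planar h. Qed.

(** A total function keeps planarity proofs out of the inductions; the default [circle] is never
    reached on a [drawn] word. *)
Definition diagram_of (w : word) : diagram :=
  match decP (@idP (wf_word w)), decP (@idP (planar w)) with
  | left h1, left h2 => Diagram true h1 h2
  | _, _ => circle
  end.

Lemma diagram_ofK w : drawn w -> code (diagram_of w) = w.
Proof.
move=> dw; have := drawn_wf dw; have := drawn_planar dw.
by rewrite /diagram_of; destruct (decP idP) => //; destruct (decP idP).
Qed.

Lemma diagram_of_outer w : outer (diagram_of w) = true.
Proof. by rewrite /diagram_of; destruct (decP idP) => //; destruct (decP idP). Qed.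

Lemma diagram_of_nil : diagram_of [::] = circle.
Proof.
rewrite /diagram_of.
destruct (decP (@idP (wf_word [::]))) as [h1|] => //.
destruct (decP (@idP (planar [::]))) as [h2|] => //.
by rewrite /circle; congr Diagram; apply: bool_irrelevance.
Qed.

Lemma local_move_of (T : template -> Prop) t w w' : drawn w -> drawn w' -> T t ->
  replaced t w w' \/ replaced t w' w -> local_move T (diagram_of w) (diagram_of w').
Proof.
move=> dw dw' Tt h; split; first by rewrite !diagram_of_outer.
by exists t => //; rewrite !diagram_ofK.
Qed.

Lemma equivalent_R1 u v a f : drawn (u ++ v) -> drawn (u ++ [:: (a, f), (a, ~~ f) & v]) ->
  equivalent (diagram_of (u ++ [:: (a, f), (a, ~~ f) & v])) (diagram_of (u ++ v)).
Proof.
move=> d1 d2; apply: rst_step; apply: Or33.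
apply: (@local_move_of _ [:: ([::], [:: (a, f); (a, ~~ f)])]) => //.
  by apply: Or31; exists a, f.
by right; exists [:: ([::], [:: (a, f); (a, ~~ f)])], u, [:: v]; rewrite /= !cats0.
Qed.

Lemma equivalent_R2 u v t a b e f : kind a = None -> kind b = None ->
  let w := u ++ v ++ t in
  let w' := u ++ [:: (a, f), (b, ~~ f) & v ++ orient e [:: (a, ~~ f); (b, f)] ++ t] in
  drawn w -> drawn w' -> equivalent (diagram_of w') (diagram_of w).
Proof.
move=> ka kb w w' d1 d2; apply: rst_step; apply: Or33.
pose T := [:: ([::], [:: (a, f); (b, ~~ f)]); ([::], orient e [:: (a, ~~ f); (b, f)])] : template.
apply: (@local_move_of _ T) => //.
  by apply: Or32; exists a, b, e, f; rewrite ka kb.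
by right; exists T, u, [:: v; t]; rewrite /= !cats0.
Qed.

(** Since [turn] ignores the base point, a rotation carries the insertion at the head of a word to
    any position. *)
Lemma faces_insert1 u p0 v a f fs :
  wf_word (u ++ p0 :: v) -> is_faces (u ++ p0 :: v) fs ->
  wf_word (u ++ [:: (a, f), (a, ~~ f), p0 & v]) ->
  exists2 fs', is_faces (u ++ [:: (a, f), (a, ~~ f), p0 & v]) fs' &
   forall F, F \in fs -> exists F',
    [/\ F' \in fs', {subset F <= F'} &
        ((p0, ~~ f) \in F -> ((a, ~~ f), f) \in F')].
Proof.
move=> wfw fsw wfw'.
have fsr : is_faces (p0 :: v ++ u) fs.
  by rewrite -cat_cons -(rot_size_cat u); apply: faces_rot => //; case/andP: wfw.
have [| |fs' fsw' sub] := faces_R1 (a := a) (f := f) _ fsr.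
- by rewrite -(@wf_perm (u ++ p0 :: v)) // perm_catC.
- by case/andP: wfw' => uw' _; move: uw'; rewrite uniq_catC.
exists fs' => //.
move: fsw' => /(faces_rot (size [:: (a, f), (a, ~~ f), p0 & v])).
rewrite -!cat_cons rot_size_cat; apply.
by case/andP: wfw' => uw' _; move: uw'; rewrite uniq_catC.
Qed.

Lemma faces_insert2 u q0 v p0 t a b e f fs F (w := u ++ q0 :: v ++ p0 :: t)
  (w' := u ++ [:: (a, f), (b, ~~ f), q0 & v ++ orient e [:: (a, ~~ f); (b, f)] ++ p0 :: t]) :
  wf_word w -> is_faces w fs -> wf_word w' -> F \in fs ->
  (q0, f (+) e) \in F -> (p0, f) \in F -> exists fs', is_faces w' fs'.
Proof.
move=> wfw fsw wfw' Ff d1 d2.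
have w'E : w' = u ++ [:: (a, f), (b, ~~ f), q0 & v ++
   [:: if e then (a, ~~ f) else (b, f), if e then (b, f) else (a, ~~ f), p0 & t]].
  by rewrite /w'; case: (e).
have fsr : is_faces (q0 :: v ++ p0 :: (t ++ u)) fs.
  have -> : q0 :: v ++ p0 :: t ++ u = rot (size u) w by rewrite rot_size_cat /= -catA.
  by apply: faces_rot => //; case/andP: wfw.
move: wfw'; rewrite w'E => wfw'.
have [| |fs' fsw'] := @faces_R2 a b e f _ _ _ _ _ _ fs F fsr Ff d1 d2.
- by rewrite -(@wf_perm w) // /w; apply/permP => Q; perm_lia Q.
- case/andP: wfw' => uw' _; move: uw'; rewrite uniq_catC.
  by rewrite /= -!catA.
exists fs'.
set x := [:: (a, f), _, q0 & _]; rewrite -(rot_size_cat x u).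
move: fsw'; have -> : [:: (a, f), (b, ~~ f), q0 & v ++ [:: if e then (a, ~~ f) else (b, f),
  if e then (b, f) else (a, ~~ f), p0 & t ++ u]] = x ++ u by rewrite /x /= -catA.
by apply: faces_rot; case/andP: wfw' => uw' _; rewrite uniq_catC.
Qed.

(** * Chains of nested kinks *)

Fixpoint alternates (s : bool) (z : word) : bool :=
  if z is p :: z' then (p.2 == s) && alternates (~~ s) z' else true.

Definition mirror (z : word) : word := rev (map other z).

Lemma mirror_rcons z p : mirror (rcons z p) = other p :: mirror z.
Proof. by rewrite /mirror map_rcons rev_rcons. Qed.

Lemma alternates_rcons s z p :
  alternates s (rcons z p) = alternates s z && (p.2 == s (+) odd (size z)).
Proof.
elim: z s => [|q z IH] s /=; first by rewrite andbT addbF.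
by rewrite IH andbA; case: (s); case: (odd _).
Qed.

(* [z ++ mirror z] is a chain of nested kinks.  With alternating sides, each kink
   turns away from the loop it is placed on, so that the innermost edge stays on
   the boundary of the region at the base point. *)
Lemma faces_turn w fs F d : is_faces w fs -> F \in fs -> d \in F -> turn w d \in F.
Proof.
by move=> [_ /allP cy _ _] /cy cF dF; rewrite (eqP (next_cycle cF dF)) mem_next.
Qed.

Lemma faces_kink c : is_faces [:: (c, true); (c, false)]
  [:: [:: ((c, true), true)]; [:: ((c, false), false)];
      [:: ((c, true), false); ((c, false), true)]].
Proof.
have e1 : ((c, false) == (c, true) :> passage) = false by rewrite xpair_eqE andbF.
split=> //.
  by rewrite /darts /=; apply/permP => Q; perm_lia Q.
have n1 : next [:: (c, true); (c, false)] (c, true) = (c, false) by rewrite next_cons.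
have uw : uniq [:: (c, true); (c, false)] by rewrite /= inE eq_sym e1.
have n2 : next [:: (c, true); (c, false)] (c, false) = (c, true).
  by rewrite -(next_rot 1 uw) next_cons.
have v1 : prev [:: (c, true); (c, false)] (c, true) = (c, false).
  by rewrite -[RHS](prev_next uw) n2.
have v2 : prev [:: (c, true); (c, false)] (c, false) = (c, true).
  by rewrite -[RHS](prev_next uw) n1.
by rewrite [all _ _]/= !turnTT !turnFT (turnFF v1) (turnTF v2) n1 n2 !eqxx.
Qed.

Lemma perm_mirror z p w :
  perm_eq (rcons z p ++ mirror (rcons z p) ++ w) [:: p, other p & z ++ mirror z ++ w].
Proof.
rewrite mirror_rcons cat_rcons /= perm_sym -cat1s -[_ :: other p :: _]/([:: p; other p] ++ _).
by apply/permP => Q; perm_lia Q.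
Qed.

Lemma chain_faces x0 z w : z != [::] -> alternates true z ->
  wf_word (z ++ mirror z ++ w) -> drawn w ->
  exists fs F, [/\ is_faces (z ++ mirror z ++ w) fs, F \in fs,
     (head x0 z, false) \in F & (head x0 (mirror z), odd (size z)) \in F].
Proof.
elim/last_ind: z => // z [c r] IH _; rewrite alternates_rcons /= => /andP[az /eqP ->] wfw dw.
have [wfz _] := wf_pairP (perm_mirror z _ w) wfw.
case: z => [|q z] in IH az wfw wfz *.
  move: wfw wfz; rewrite /mirror /rev /=.
  case: w dw {IH} => [_ _ _|p0 w [wfp [//|[fs fsw]]] wfw wfz].
    (* A kink on the bare circle subdivides no edge of a word, so its three regions are given by
       hand. *)
    eexists; exists [:: ((c, true), false); ((c, false), true)]; split; first exact: faces_kink.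
    - by rewrite !inE eqxx !orbT.
    - by rewrite !inE eqxx.
    - by rewrite !inE eqxx !orbT.
  have [fs' fsw' sub] := @faces_insert1 [::] p0 w c true fs wfp fsw wfw.
  have [F [Ff p0F _]] := faces_cover (d := (p0, false)) fsw (mem_head _ _).
  have [F' [Ff' _ h]] := sub F Ff.
  exists fs', F'; split=> //; last exact: h.
  exact: faces_turn fsw' Ff' (h p0F).
have [fs [F [fsw Ff hF mF]]] := IH isT az wfz dw.
have : exists p0 m, mirror (q :: z) = p0 :: m.
  by exists (other (last q z)), (mirror (belast q z)); rewrite {1}lastI mirror_rcons.
case=> p0 [m mE]; rewrite mE in mF fsw wfz.
move: wfw; rewrite mirror_rcons mE cat_rcons => wfw.
(* [F] lies on the side [odd (size (q :: z))] of the innermost edge. Alternation gives the first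
   letter of the new kink the opposite side, so by the last clause of [faces_insert1] the outer side
   of the new loop is again on this region. *)
have [fs' fsw' sub] := faces_insert1 wfz fsw wfw.
have [F' [Ff' sF h]] := sub F Ff.
exists fs', F'; split=> //.
- exact: sF hF.
by rewrite size_rcons oddS /other [head _ _]/= negbK; move: h; rewrite negbK; apply.
Qed.

Lemma drawn_chain z w : alternates true z -> wf_word (z ++ mirror z ++ w) -> drawn w ->
  drawn (z ++ mirror z ++ w).
Proof.
move=> az wfz dw; case: z az wfz => [|q z] // az wfz.
have [//|fs [F [fsw _ _ _]]] := chain_faces q _ az wfz dw.
by split=> //; right; exists fs.
Qed.

(** The innermost kink encloses no letter, so a Reidemeister move I removes it, and the next one
    becomes innermost. *)
Lemma equivalent_chain z w : alternates true z -> wf_word (z ++ mirror z ++ w) -> drawn w ->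
  equivalent (diagram_of (z ++ mirror z ++ w)) (diagram_of w).
Proof.
elim/last_ind: z => [|z p IH] az wfw dw; first exact: rst_refl.
have [wfz _] := wf_pairP (perm_mirror z p w) wfw.
have az' : alternates true z by move: az; rewrite alternates_rcons => /andP[].
apply: rst_trans (IH az' wfz dw).
have := drawn_chain az wfw dw; rewrite mirror_rcons cat_rcons /= => d.
case: p d {az wfw} => c s d; apply: equivalent_R1 d.
exact: drawn_chain.
Qed.

(** * Four families of planar words *)

Section Blocks.
Variables (z w : word).
Hypotheses (z0 : z != [::]) (az : alternates true z) (dw : drawn w).
Let block (s t : word) : word := s ++ z ++ t ++ mirror z ++ w.

Lemma perm_block p s1 s2 t :
  perm_eq (block (s1 ++ [:: p, other p & s2]) t) [:: p, other p & block (s1 ++ s2) t].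
Proof. by apply/permP => Q; rewrite /block; perm_lia Q. Qed.

Lemma perm_block2 p s1 s2 t :
  perm_eq (block s1 (s2 ++ [:: p, other p & t])) [:: p, other p & block s1 (s2 ++ t)].
Proof. by apply/permP => Q; rewrite /block; perm_lia Q. Qed.

Lemma perm_block_R2 a b e f s1 s2 t1 t2 :
  perm_eq (block (s1 ++ [:: (a, f), (b, ~~ f) & s2]) (t1 ++ orient e [:: (a, ~~ f); (b, f)] ++ t2))
    [:: (a, f), other (a, f), (b, f), other (b, f) & block (s1 ++ s2) (t1 ++ t2)].
Proof.
by apply/permP => Q; rewrite /block /other /=; case: e; case: f; perm_lia Q.
Qed.

Let zE : exists q s p t, z = q :: s /\ mirror z = p :: t.
Proof.
case: z z0 => // q s _; exists q, s, (other (last q s)), (mirror (belast q s)).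
by split=> //; rewrite lastI mirror_rcons.
Qed.

(* In the words below, [s] lies at the base point and [t] at the centre of the
   chain: the two edges are first clasped together by a Reidemeister move II, and
   kinks (and, for grids, a second clasp between two kinks) complete the pattern. *)
Lemma faces_clasp a b f : odd (size z) = f ->
  let w' := block [:: (a, f); (b, ~~ f)] (orient f [:: (a, ~~ f); (b, f)]) in
  wf_word w' -> (exists fs, is_faces w' fs) /\
  (kind a = None -> kind b = None -> equivalent (diagram_of w') (diagram_of w)).
Proof.
move=> oz w' wfw'.
have pe : perm_eq w' [:: (a, f), other (a, f), (b, f), other (b, f) & z ++ mirror z ++ w].
  by apply/permP => Q; rewrite /w' /block /other; case: (f); perm_lia Q.
have [wf1 _] := wf_pairP pe wfw'.
have [wfz _] := wf_pairP (perm_refl _) wf1.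
have fw' : exists fs, is_faces w' fs.
  have [q [s [p [t [E1 E2]]]]] := zE.
  have [fs [F [fsw Ff h1 h2]]] := chain_faces q z0 az wfz dw.
  move: wfw' fsw h1 h2 wfz; rewrite /w' /block oz E2 E1 => wfw' fsw h1 h2 wfz.
  (* Choosing [e] equal to [f] makes the side needed on the outermost edge [f (+) f], that is
     [false], the one supplied by [chain_faces]. *)
  apply: (@faces_insert2 [::] q s p (t ++ w) a b f f fs F) => //.
  by rewrite addbb.
split=> // ka kb; apply: rst_trans (equivalent_chain az wfz dw).
have d1 : drawn w' by split=> //; right.
by have := @equivalent_R2 [::] z (mirror z ++ w) a b f f ka kb (drawn_chain az wfz dw) d1.
Qed.

(** The strands carrying the sides ca and ab lie at the base point, the one carrying bc at the
    centre. Thus [c] and [b] form the clasp, and [a] is a kink between its letters. *)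
Definition circ_word a b c :=
  block [:: (c, false); (a, true); (a, false); (b, true)] [:: (b, false); (c, true)].

Lemma circ_drawn a b c : ~~ odd (size z) -> wf_word (circ_word a b c) ->
  drawn (circ_word a b c) /\
  (all is_virtual [:: a; b; c] ->
   equivalent (diagram_of (circ_word a b c)) (diagram_of w)).
Proof.
move=> /negbTE oz wfW.
have [wf1 _] := wf_pairP (@perm_block (a, true) [:: (c, false)] [:: (b, true)] _) wfW.
have [[fs fs1] eq1] := faces_clasp oz wf1.
have [fs' fsW _] := @faces_insert1 [:: (c, false)] (b, true) _ a true fs wf1 fs1 wfW.
have dW : drawn (circ_word a b c) by split=> //; right; exists fs'.
split=> // /and4P[/eqP va /eqP vb /eqP vc _]; apply: rst_trans (eq1 vc vb).
have d1 : drawn (block [:: (c, false); (b, true)] [:: (b, false); (c, true)]).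
  by split=> //; right; exists fs.
exact: (@equivalent_R1 [:: (c, false)] _ a true d1 dW).
Qed.

(** The reversed strand, carrying ca, lies at the centre. The clasp of [a] and [c] has [f = true],
    which calls for a chain of odd length; [b] is the kink. *)
Definition wedge_word a b c :=
  block [:: (a, true); (b, true); (b, false); (c, false)] [:: (a, false); (c, true)].

Lemma wedge_drawn a b c : odd (size z) -> wf_word (wedge_word a b c) ->
  drawn (wedge_word a b c) /\
  (all is_virtual [:: a; b; c] ->
   equivalent (diagram_of (wedge_word a b c)) (diagram_of w)).
Proof.
move=> oz wfW.
have [wf1 _] := wf_pairP (@perm_block (b, true) [:: (a, true)] [:: (c, false)] _) wfW.
have [[fs fs1] eq1] := faces_clasp oz wf1.
have [fs' fsW _] := @faces_insert1 [:: (a, true)] (c, false) _ b true fs wf1 fs1 wfW.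
have dW : drawn (wedge_word a b c) by split=> //; right; exists fs'.
split=> // /and4P[/eqP va /eqP vb /eqP vc _]; apply: rst_trans (eq1 va vc).
have d1 : drawn (block [:: (a, true); (c, false)] [:: (a, false); (c, true)]).
  by split=> //; right; exists fs.
exact: (@equivalent_R1 [:: (a, true)] _ b true d1 dW).
Qed.

(** Four strands call for two clasps, [r] with [b] and [c] with [k]; [r] and [k] are meant to be
    virtual both before and after the move. The kinks are [a] and [d]. *)
Definition sharp_word a b c d r k :=
  block [:: (r, false); (a, false); (c, false); (k, true); (a, true); (b, true)]
    [:: (b, false); (d, false); (k, false); (c, true); (d, true); (r, true)].

Lemma sharp_drawn a b c d r k : ~~ odd (size z) -> wf_word (sharp_word a b c d r k) ->
  drawn (sharp_word a b c d r k) /\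
  (all is_virtual [:: a; b; c; d; r; k] ->
   equivalent (diagram_of (sharp_word a b c d r k)) (diagram_of w)).
Proof.
move=> /negbTE oz wfW.
have [wf4 _] := wf_pairP (@perm_block_R2 c k false false [:: (r, false); (a, false)]
  [:: (a, true); (b, true)] [:: (b, false); (d, false)] [:: (d, true); (r, true)]) wfW.
have [wf3 _] := wf_pairP (perm_refl _) wf4; rewrite [_ ++ _]/= [X in block _ X]/= in wf3.
have [wf2 _] := wf_pairP (@perm_block2 (d, false) _ [:: (b, false)] [:: (r, true)]) wf3.
have [wf1 _] := wf_pairP (@perm_block (a, false) [:: (r, false)] [:: (b, true)] _) wf2.
have [[fs1 fsw1] eq1] := faces_clasp oz wf1.
(* One region along both edges that receive a kink: the outer sides of both loops then lie on it,
   and the second clasp can be made there. *)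
have [F1 [Ff1 bF rF]] : exists F, [/\ F \in fs1, ((b, true), true) \in F & ((r, true), true) \in F].
  have [|F [Ff h1 h2]] := faces_cover (d := ((b, true), true)) fsw1.
    by rewrite /block !inE eqxx !orbT.
  exists F; split=> //; move: h2; rewrite turnTT.
  set v := block _ _.
  suff -> : next v (b, false) = (r, true) by [].
  have -> : v = ([:: (r, false); (b, true)] ++ z) ++ [:: (b, false), (r, true) & mirror z ++ w].
    by rewrite -catA.
  by apply: next_cat; rewrite -catA; case/andP: wf1.
have [fs2 fsw2 sub2] := @faces_insert1 [:: (r, false)] (b, true) _ a false fs1 wf1 fsw1 wf2.
have [F2 [Ff2 s2 h2]] := sub2 _ Ff1.
have aF := h2 bF.
have d2 : drawn (block [:: (r, false); (a, false); (a, true); (b, true)] [:: (b, false); (r, true)]).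
  by split=> //; right; exists fs2.
have d1 : drawn (block [:: (r, false); (b, true)] [:: (b, false); (r, true)]).
  by split=> //; right; exists fs1.
pose u := ([:: (r, false); (a, false); (a, true); (b, true)] ++ z) ++ [:: (b, false)].
have wu t : u ++ t ++ mirror z ++ w =
    block [:: (r, false); (a, false); (a, true); (b, true)] ((b, false) :: t).
  by rewrite /u /block -!catA.
have [| | |fs3 fsw3 sub3] := @faces_insert1 u (r, true) (mirror z ++ w) d false fs2.
- by rewrite (wu [:: (r, true)]).
- by rewrite (wu [:: (r, true)]).
- by rewrite (wu [:: (d, false); (d, true); (r, true)]).
rewrite (wu [:: (d, false); (d, true); (r, true)]) in fsw3.
have [F3 [Ff3 s3 h3]] := sub3 _ Ff2.
have dF := h3 (s2 _ rF).
have d3 : drawn (block [:: (r, false); (a, false); (a, true); (b, true)]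
    [:: (b, false); (d, false); (d, true); (r, true)]).
  by split=> //; right; exists fs3.
have [] : exists fs, is_faces (sharp_word a b c d r k) fs.
  pose v := (b, true) :: z ++ [:: (b, false); (d, false)].
  have vE s t : (s ++ v) ++ t ++ mirror z ++ w =
     block (s ++ [:: (b, true)]) ([:: (b, false); (d, false)] ++ t).
    by rewrite /block /v /= -!catA /= -!catA.
  have := @faces_insert2 [:: (r, false); (a, false)] (a, true) v (d, true)
    ((r, true) :: mirror z ++ w) c k false false fs3 F3.
  have e1 : (a, true) :: v ++ (d, true) :: (r, true) :: mirror z ++ w =
    [:: (a, true), (b, true) & z ++ [:: (b, false), (d, false), (d, true), (r, true) & mirror z ++ w]].
    by rewrite /v /= -catA.
  have e2 : (a, true) :: v ++ orient false [:: (c, true); (k, false)] ++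
      (d, true) :: (r, true) :: mirror z ++ w =
    [:: (a, true), (b, true) & z ++ [:: (b, false), (d, false), (k, false),
        (c, true), (d, true), (r, true) & mirror z ++ w]].
    by rewrite /v /= -catA.
  rewrite e1 e2; apply=> //; exact: s3.
move=> fs4 fsw4.
have dW : drawn (sharp_word a b c d r k) by split=> //; right; exists fs4.
split=> // /and5P[/eqP va /eqP vb /eqP vc /eqP vd /and3P[/eqP vr /eqP vk _]].
apply: rst_trans (eq1 vr vb).
apply: rst_trans (@equivalent_R1 [:: (r, false)] _ a false d1 d2).
have := @equivalent_R1 u ((r, true) :: mirror z ++ w) d false.
rewrite (wu [:: (r, true)]) (wu [:: (d, false); (d, true); (r, true)]) => /(_ d2 d3).
apply: rst_trans.
have := @equivalent_R2 [:: (r, false); (a, false)]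
  ([:: (a, true); (b, true)] ++ z ++ [:: (b, false); (d, false)])
  ([:: (d, true); (r, true)] ++ mirror z ++ w) c k false false vc vk.
by rewrite /= -!catA /=; apply.
Qed.

Definition pass_word a b c d r k :=
  block [:: (r, false); (a, true); (b, false); (k, true); (a, false); (c, true)]
    [:: (d, false); (b, true); (k, false); (d, true); (c, false); (r, true)].

Lemma pass_drawn a b c d r k : ~~ odd (size z) -> wf_word (pass_word a b c d r k) ->
  drawn (pass_word a b c d r k) /\
  (all is_virtual [:: a; b; c; d; r; k] ->
   equivalent (diagram_of (pass_word a b c d r k)) (diagram_of w)).
Proof.
move=> /negbTE oz wfW.
have [wf4 _] := wf_pairP (@perm_block_R2 b k true false [:: (r, false); (a, true)]
  [:: (a, false); (c, true)] [:: (d, false)] [:: (d, true); (c, false); (r, true)]) wfW.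
have [wf3 _] := wf_pairP (perm_refl _) wf4; rewrite [_ ++ _]/= [X in block _ X]/= in wf3.
have [wf2 _] := wf_pairP (@perm_block2 (d, false) _ [::] [:: (c, false); (r, true)]) wf3.
have [wf1 _] := wf_pairP (@perm_block (a, true) [:: (r, false)] [:: (c, true)] _) wf2.
have [[fs1 fsw1] eq1] := faces_clasp oz wf1.
(* Here the two edges that receive the kinks carry consecutive sides of a region, met when turning
   at [c]. *)
have [F1 [Ff1 cF rF]] : exists F, [/\ F \in fs1, ((c, false), true) \in F & ((c, true), false) \in F].
  have [|F [Ff h1 h2]] := faces_cover (d := ((c, false), true)) fsw1.
    by rewrite /block !mem_cat !inE eqxx !orbT.
  by exists F.
have [fs2 fsw2 sub2] := @faces_insert1 [:: (r, false)] (c, true) _ a true fs1 wf1 fsw1 wf2.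
have [F2 [Ff2 s2 h2]] := sub2 _ Ff1.
have aF := h2 rF.
have d2 : drawn (block [:: (r, false); (a, true); (a, false); (c, true)] [:: (c, false); (r, true)]).
  by split=> //; right; exists fs2.
have d1 : drawn (block [:: (r, false); (c, true)] [:: (c, false); (r, true)]).
  by split=> //; right; exists fs1.
pose u := [:: (r, false); (a, true); (a, false); (c, true)] ++ z.
have wu t : u ++ t ++ mirror z ++ w =
    block [:: (r, false); (a, true); (a, false); (c, true)] t.
  by rewrite /u /block -!catA.
have [| | |fs3 fsw3 sub3] := @faces_insert1 u (c, false) ((r, true) :: mirror z ++ w) d false fs2.
- by rewrite (wu [:: (c, false); (r, true)]).
- by rewrite (wu [:: (c, false); (r, true)]).
- by rewrite (wu [:: (d, false); (d, true); (c, false); (r, true)]).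
rewrite (wu [:: (d, false); (d, true); (c, false); (r, true)]) in fsw3.
have [F3 [Ff3 s3 h3]] := sub3 _ Ff2.
have dF := h3 (s2 _ cF).
have d3 : drawn (block [:: (r, false); (a, true); (a, false); (c, true)]
    [:: (d, false); (d, true); (c, false); (r, true)]).
  by split=> //; right; exists fs3.
have [] : exists fs, is_faces (pass_word a b c d r k) fs.
  pose v := (c, true) :: z ++ [:: (d, false)].
  have := @faces_insert2 [:: (r, false); (a, true)] (a, false) v (d, true)
    [:: (c, false), (r, true) & mirror z ++ w] b k true false fs3 F3.
  have e1 : (a, false) :: v ++ [:: (d, true), (c, false), (r, true) & mirror z ++ w] =
    [:: (a, false), (c, true) & z ++ [:: (d, false), (d, true), (c, false), (r, true) & mirror z ++ w]].
    by rewrite /v /= -catA.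
  have e2 : (a, false) :: v ++ orient true [:: (b, true); (k, false)] ++
      [:: (d, true), (c, false), (r, true) & mirror z ++ w] =
    [:: (a, false), (c, true) & z ++ [:: (d, false), (b, true), (k, false),
        (d, true), (c, false), (r, true) & mirror z ++ w]].
    by rewrite /v /= -catA.
  rewrite e1 e2; apply=> //; exact: s3.
move=> fs4 fsw4.
have dW : drawn (pass_word a b c d r k) by split=> //; right; exists fs4.
split=> // /and5P[/eqP va /eqP vb /eqP vc /eqP vd /and3P[/eqP vr /eqP vk _]].
apply: rst_trans (eq1 vr vc).
apply: rst_trans (@equivalent_R1 [:: (r, false)] _ a true d1 d2).
have := @equivalent_R1 u [:: (c, false), (r, true) & mirror z ++ w] d false.
rewrite (wu [:: (c, false); (r, true)])
  (wu [:: (d, false); (d, true); (c, false); (r, true)]) => /(_ d2 d3).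
apply: rst_trans.
have := @equivalent_R2 [:: (r, false); (a, true)]
  ([:: (a, false); (c, true)] ++ z ++ [:: (d, false)])
  ([:: (d, true); (c, false); (r, true)] ++ mirror z ++ w) b k true false vb vk.
by rewrite /= -!catA /=; apply.
Qed.
End Blocks.

(** * Index-weighted writhes *)

Local Open Scope ring_scope.

Section Invariant.
Variables (V : comNzRingType) (g : V -> int).

Definition sgn (R : comNzRingType) (s : bool) : R := if s then 1 else -1.

Definition weight (p : passage) : V := if is_virtual p.1 then 0 else sgn V p.2.

Definition weights (w : word) : V := \sum_(p <- w) weight p.

Fixpoint heights (h : V) (w : word) : seq (passage * V) :=
  if w is p :: w' then (p, h) :: heights (h + weight p) w' else [::].

(* [M] lists letters together with the sum of the weights before them, so that
   [y.2 - x.2 - sgn x.1.2] is the sum of the weights strictly between the over-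
   passage [x] and the under-passage [y], that is the index of the crossing.  Its
   sign is [sgn x.1.2], because the over-passage of a positive crossing has side
   [true]. *)
Definition writhe (M : seq (passage * V)) : int :=
  \sum_(x <- M) \sum_(y <- M | is_over x.1 && (y.1 == other x.1))
    sgn int x.1.2 * g (y.2 - x.2 - sgn V x.1.2).

Definition word_writhe (w : word) : int := writhe (heights 0 w).

(** The contribution of one crossing, with [h] and [k] the heights of its passages of side [true]
    and [false]. At a negative crossing the over-passage has side [false], which exchanges their
    roles. *)
Definition chord (c : crossing) (h k : V) : int :=
  match kind c with
  | None => 0
  | Some true => g (k - h - 1)
  | Some false => - g (h - k + 1)
  end.

Lemma heights_cat h u v : heights h (u ++ v) = heights h u ++ heights (h + weights u) v.
Proof.
rewrite /weights; elim: u h => [|p u IH] h /=; first by rewrite big_nil addr0.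
by rewrite IH big_cons addrA.
Qed.

Lemma weights_cat u v : weights (u ++ v) = weights u + weights v.
Proof. by rewrite /weights big_cat. Qed.

Lemma heights_fst h w : map fst (heights h w) = w.
Proof. by elim: w h => //= p w IH h; rewrite IH. Qed.

Lemma heights_shift h k w :
  heights (h + k) w = [seq (x.1, x.2 + k) | x <- heights h w].
Proof. by elim: w h => //= p w IH h; rewrite addrAC IH. Qed.

Lemma writhe_perm M N : perm_eq M N -> writhe M = writhe N.
Proof.
move=> pe; rewrite /writhe (perm_big _ pe); apply: eq_bigr => x _.
exact: perm_big.
Qed.

Lemma writhe_shift k M : writhe [seq (x.1, x.2 + k) | x <- M] = writhe M.
Proof.
rewrite /writhe big_map; apply: eq_bigr => x _; rewrite big_map; apply: eq_bigr => y _ /=.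
by congr (_ * g (_ - _)); ring.
Qed.

Lemma writhe_cat M N : (forall x y, x \in M -> y \in N -> x.1.1 != y.1.1) ->
  writhe (M ++ N) = writhe M + writhe N.
Proof.
move=> dis; rewrite /writhe big_cat /=; congr (_ + _).
  rewrite [LHS]big_seq [RHS]big_seq; apply: eq_bigr => x xM; rewrite big_cat /= [X in _ + X]big_seq_cond.
  rewrite [X in _ + X]big1 ?addr0 // => y /and3P[yN _ /eqP e].
  by have := dis x y xM yN; rewrite e eqxx.
rewrite [LHS]big_seq [RHS]big_seq; apply: eq_bigr => x xN; rewrite big_cat /= [X in X + _]big_seq_cond.
rewrite [X in X + _]big1 ?add0r // => y /and3P[yM _ /eqP e].
by have := dis y x yM xN; rewrite e eqxx.
Qed.

Lemma writhe_chord c h k : writhe [:: ((c, true), h); ((c, false), k)] = chord c h k.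
Proof.
rewrite /writhe !big_cons !big_nil /= /other /is_over /chord /= !xpair_eqE eqxx /=.
by case: (kind c) => [[]|] //=; rewrite /sgn /= ?opprK; ring.
Qed.

Lemma writhe_nil : writhe [::] = 0.
Proof. by rewrite /writhe big_nil. Qed.

Lemma writhe_chord_cons c h k M : c \notin [seq x.1.1 | x <- M] ->
  writhe [:: ((c, true), h), ((c, false), k) & M] = chord c h k + writhe M.
Proof.
move=> cM; rewrite -writhe_chord -writhe_cat // => x y xc yM.
have -> : x.1.1 = c by move: xc; rewrite !inE => /orP[]/eqP->.
by apply: contra cM => /eqP ->; apply: map_f.
Qed.

Definition other_closed (w : word) := all (fun p => other p \in w) w.

Lemma writhe_cat_closed M N : uniq (map fst (M ++ N)) -> other_closed (map fst N) ->
  writhe (M ++ N) = writhe M + writhe N.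
Proof.
rewrite map_cat cat_uniq => /and3P[_ /hasPn dis _] /allP cl; apply: writhe_cat => x y xM yN.
apply/eqP => e; have xM' : x.1 \in map fst M by apply: map_f.
have yN' : y.1 \in map fst N by apply: map_f.
suff /dis : x.1 \in map fst N by rewrite /= xM'.
case: (x.1) (y.1) e yN' (cl _ yN') => c s [d r] /= -> h1 h2.
by have [->//|rs] := eqVneq s r; have -> : s = ~~ r by case: (s) (r) rs => -[].
Qed.

Lemma sum_weights_wf w : wf_word w -> weights w = 0.
Proof.
case/andP=> uw /allP cl; rewrite /weights (bigID (fun p : passage => p.2)) /=.
rewrite [X in _ + X](_ : _ = \sum_(p <- map other w | p.2) - weight p).
  rewrite sumrN.
  have pe : perm_eq w (map other w).
    apply: uniq_perm => //; first by rewrite map_inj_uniq //; apply: inv_inj; apply: otherK.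
    move=> p; apply/idP/mapP => [pw|[q qw ->]]; last exact: cl.
    by exists (other p); [exact: cl|rewrite otherK].
  by rewrite -(perm_big _ pe) subrr.
rewrite big_map; apply: eq_bigr => -[c []] //= _.
by rewrite /weight /=; case: is_virtual; rewrite /sgn /= ?oppr0.
Qed.

(** The total weight is zero, so moving the base point shifts all heights by one constant, and only
    differences of heights matter. *)
Lemma word_writhe_rot i w : wf_word w -> word_writhe (rot i w) = word_writhe w.
Proof.
move=> wfw; rewrite /word_writhe -[w in RHS](cat_take_drop i) /rot !heights_cat !add0r.
have w0 : weights (drop i w) + weights (take i w) = 0.
  by rewrite addrC -weights_cat cat_take_drop sum_weights_wf.
rewrite -(writhe_shift (weights (take i w))) map_cat -!heights_shift w0 add0r.
by apply: writhe_perm; rewrite perm_catC.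
Qed.

Lemma word_writhe_renaming (f : crossing -> crossing) w : {in map fst w &, injective f} ->
  (forall c, kind (f c) = kind c) -> word_writhe [seq (f p.1, p.2) | p <- w] = word_writhe w.
Proof.
move=> fi fk; rewrite /word_writhe.
have hE h : heights h [seq (f p.1, p.2) | p <- w] =
    [seq ((f x.1.1, x.1.2), x.2) | x <- heights h w].
  elim: (w) h => //= p u IH h; rewrite IH /weight /is_virtual /= fk //.
rewrite hE /writhe big_map; rewrite [LHS]big_seq [RHS]big_seq; apply: eq_bigr => x xM.
rewrite big_map /= big_seq_cond [RHS]big_seq_cond; apply: eq_bigl => y.
case yM: (y \in _) => //=; rewrite /is_over /= fk; congr (_ && _).
have inw z : z \in heights 0 w -> z.1.1 \in map fst w.
  by move=> zM; rewrite -(heights_fst 0 w) -map_comp; apply/mapP; exists z.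
rewrite /other /= !xpair_eqE; case: (y) (x) (inw _ yM) (inw _ xM) => -[c s] h [[d r] k] /= cw dw.
by rewrite (inj_in_eq fi).
Qed.

(** A block that keeps its total weight leaves all later heights unchanged. So both words share the
    part [C], and matching blocks are entered at the same height. *)
Lemma heights_replaced (r : template) (us : seq word) h :
  size us = size r -> (forall x, x \in r -> weights x.1 = weights x.2) ->
  exists (C : seq (passage * V)) (zs : seq ((word * word) * V)),
   [/\ map fst zs = r,
       perm_eq (heights h (flatten [seq x.1.1 ++ x.2 | x <- zip r us]))
         (C ++ flatten [seq heights y.2 y.1.1 | y <- zs])
     & perm_eq (heights h (flatten [seq x.1.2 ++ x.2 | x <- zip r us]))
         (C ++ flatten [seq heights y.2 y.1.2 | y <- zs])].
Proof.
elim: r us h => [|x r IH] [|u us] h //=; first by exists [::], [::].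
move=> [su] we.
have [|C [zs [zE p1 p2]]] := IH us (h + weights (x.1 ++ u)) su.
  by move=> y yr; apply: we; rewrite inE yr orbT.
exists (heights (h + weights x.1) u ++ C), ((x, h) :: zs); split=> /=; first by rewrite zE.
- rewrite !heights_cat; move/permP: p1 => p1; apply/permP => Q.
  rewrite !count_cat p1; perm_lia Q.
have wx : weights x.1 = weights x.2 by apply: we; rewrite mem_head.
rewrite !heights_cat -wx; move: p2; rewrite !weights_cat -wx => /permP p2; apply/permP => Q.
rewrite !count_cat p2; perm_lia Q.
Qed.

Lemma perm_map_lift (A B : eqType) (f : A -> B) (s : seq A) (t : seq B) :
  perm_eq (map f s) t -> exists2 s', perm_eq s s' & map f s' = t.
Proof.
case: s => [|x0 s]; first by rewrite perm_sym => /perm_nilP ->; exists [::].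
rewrite perm_sym => /(perm_iotaP (f x0))[is_ pis ->]; exists [seq nth x0 (x0 :: s) i | i <- is_].
  by rewrite perm_sym; apply/(perm_iotaP x0); exists is_ => //; move: pis; rewrite size_map.
rewrite -map_comp; apply/eq_in_map => i ii /=.
rewrite -[f x0 :: map f s]/(map f (x0 :: s)) (nth_map x0) //.
by move: ii; rewrite (perm_mem pis) mem_iota size_map.
Qed.

Lemma heights_blocks_fst (zs : seq ((word * word) * V)) (f : word * word -> word) :
  map fst (flatten [seq heights y.2 (f y.1) | y <- zs]) = flatten (map f (map fst zs)).
Proof. by elim: zs => //= y zs IH; rewrite map_cat heights_fst IH. Qed.

(** Both passages of a crossing in the disk lie in the blocks, so the writhe splits into an outer
    and an inner sum; the outer one does not change. *)
Lemma word_writhe_replaced t w w' : wf_word w -> wf_word w' -> replaced t w w' ->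
  (forall x, x \in t -> weights x.1 = weights x.2) ->
  other_closed (flatten (map fst t)) -> other_closed (flatten (map snd t)) ->
  exists zs : seq ((word * word) * V),
   [/\ map fst zs = t, uniq (flatten (map fst t)), uniq (flatten (map snd t)) &
     word_writhe w' - word_writhe w = writhe (flatten [seq heights y.2 y.1.2 | y <- zs])
       - writhe (flatten [seq heights y.2 y.1.1 | y <- zs])].
Proof.
move=> /andP[uw _] /andP[uw' _] [r [u0 [us [rt su wE w'E]]]] we c1 c2.
have [|C [zs0 [zE p1 p2]]] := @heights_replaced r us (weights u0) su.
  by move=> x xr; apply: we; rewrite -(perm_mem rt).
(* The entry heights come in the order of visit along the circle; they are rearranged into the order
   of the template. *)
have [|zs pz zsE] := @perm_map_lift _ _ fst zs0 t; first by rewrite zE.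
have p1' : perm_eq (heights 0 w) ((heights 0 u0 ++ C) ++ flatten [seq heights y.2 y.1.1 | y <- zs]).
  rewrite wE heights_cat add0r -catA perm_cat2l (perm_trans p1) // perm_cat2l.
  by apply/perm_flatten/perm_map.
have p2' : perm_eq (heights 0 w') ((heights 0 u0 ++ C) ++ flatten [seq heights y.2 y.1.2 | y <- zs]).
  rewrite w'E heights_cat add0r -catA perm_cat2l (perm_trans p2) // perm_cat2l.
  by apply/perm_flatten/perm_map.
have u1 := perm_uniq (perm_map fst p1'); rewrite heights_fst uw in u1.
have u2 := perm_uniq (perm_map fst p2'); rewrite heights_fst uw' in u2.
have b1 : map fst (flatten [seq heights y.2 y.1.1 | y <- zs]) = flatten (map fst t).
  by rewrite (heights_blocks_fst zs fst) zsE.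
have b2 : map fst (flatten [seq heights y.2 y.1.2 | y <- zs]) = flatten (map snd t).
  by rewrite (heights_blocks_fst zs snd) zsE.
exists zs; split=> //.
- by move: u1; rewrite map_cat b1 cat_uniq => /esym /and3P[].
- by move: u2; rewrite map_cat b2 cat_uniq => /esym /and3P[].
move: (_ ++ C) p1' p2' u1 u2 => M p1' p2' u1 u2.
rewrite /word_writhe (writhe_perm p1') (writhe_perm p2')
  !writhe_cat_closed ?b1 ?b2 ?(esym u1) ?(esym u2) //.
by ring.
Qed.

Lemma writhe_virtual M : all (fun x => is_virtual x.1.1) M -> writhe M = 0.
Proof.
move=> /allP av; rewrite /writhe big_seq big1 // => x xM; rewrite big1 // => y /andP[].
by move: (av x xM); rewrite /is_over /is_virtual => /eqP ->.
Qed.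

Lemma writhe_pick c s h k M1 M2 : c \notin [seq x.1.1 | x <- M1 ++ M2] ->
  writhe (((c, s), h) :: M1 ++ ((c, ~~ s), k) :: M2) =
    (if s then chord c h k else chord c k h) + writhe (M1 ++ M2).
Proof.
move=> cM; have -> : (if s then chord c h k else chord c k h) + writhe (M1 ++ M2) =
    writhe [:: ((c, s), h), ((c, ~~ s), k) & M1 ++ M2].
  case: s; first by rewrite writhe_chord_cons.
  rewrite -writhe_chord_cons //; apply: writhe_perm; apply/permP => Q; perm_lia Q.
apply: writhe_perm; apply/permP => Q; perm_lia Q.
Qed.

Definition mu (c : crossing) : V := (is_real c)%:R.

Lemma weightE c s : weight (c, s) = if s then mu c else - mu c.
Proof.
rewrite /weight /mu /is_real /is_virtual /=; case: (kind c) => [k|] /=; rewrite ?oppr0; by case: s.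
Qed.

Lemma weights_rev s : weights (rev s) = weights s.
Proof. by rewrite /weights; apply: perm_big; rewrite perm_rev. Qed.

Lemma weights2 p q : weights [:: p; q] = weight p + weight q.
Proof. by rewrite /weights !big_cons big_nil addr0. Qed.

Lemma chord_eq c h k h' k' : (is_real c -> k - h = k' - h') -> chord c h k = chord c h' k'.
Proof.
rewrite /chord /is_real; case: (kind c) => [[]|] //= /(_ isT) e; first by rewrite e.
by have -> : h - k = h' - k' by rewrite -[LHS]opprB e opprB.
Qed.
End Invariant.

Arguments chord : simpl never.

(* Split off the crossing of the first letter of an explicit list. *)
Ltac find_crossing c M k := lazymatch M with
  | ((c, ?s, ?x) :: ?M2)%SEQ => let T := type of x in k (@nil (passage * T)) x M2
  | (?y :: ?M2)%SEQ => find_crossing c M2 ltac:(fun M1 x M3 => k (cons y M1) x M3)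
  end.
Ltac pick_with solve_fresh := lazymatch goal with
  |- context [writhe ?g (((?c, ?s, ?h) :: ?M)%SEQ)] =>
    find_crossing c M ltac:(fun M1 x M2 =>
      let H := fresh in
      have H := @writhe_pick _ g c s h x M1 M2; rewrite /= in H; rewrite {}H;
      last by solve_fresh)
  end.

Ltac pick := pick_with ltac:(rewrite ?inE ?negb_or; do ?[apply/andP; split]).

Ltac same_chord a Ha := lazymatch goal with |- ?L = ?R =>
  lazymatch L with context [chord ?g a ?x ?y] =>
  lazymatch R with context [chord g a ?x' ?y'] =>
    have -> : chord g a x y = chord g a x' y' by apply: chord_eq => /Ha ->; ring
  end end end.

Ltac unit_bound g H := repeat match goal with
  |- context [g ?x] => move: (g x) (H x) end; clear; lia.

(** * Change of the writhe inside the disk of a move *)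

Section Moves.
Variables (V : comNzRingType) (g : V -> int).
Hypothesis g0 : g 0 = 0.

(** The two crossings have equal indices and opposite signs. *)
Lemma writhe_R2 a b e f h k : kind b = omap negb (kind a) ->
  uniq ([:: (a, f); (b, ~~ f)] ++ orient e [:: (a, ~~ f); (b, f)]) ->
  writhe g (heights h [:: (a, f); (b, ~~ f)] ++ heights k (orient e [:: (a, ~~ f); (b, f)])) = 0.
Proof.
move=> kb u; have ab : a != b.
  by apply/eqP => E; move: u; rewrite E; case: (e); case: (f); rewrite /= !inE !eqxx ?orbT.
have ba := ab; rewrite eq_sym in ba.
case: e f {u} => -[] /=; rewrite ?weightE /=.
all: do 2 pick; rewrite writhe_nil addr0.
all: move: kb; rewrite /mu /is_real /chord; case: (kind a) => [[]|] //= ->; rewrite /= ?addr0.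
all: try by [].
all: lazymatch goal with
 | |- g ?x - g ?y = 0 => have -> : x = y by ring
 | |- - g ?x + g ?y = 0 => have -> : x = y by ring
 end; by rewrite ?subrr ?addNr.
Qed.

Lemma writhe_R1 a f h : writhe g (heights h [:: (a, f); (a, ~~ f)]) = 0.
Proof.
case: f; rewrite /= ?weightE; pick; rewrite writhe_nil addr0 /chord /mu /is_real;
case: (kind a) => [[]|] //=; rewrite -[RHS]g0.
- by congr g; ring.
- by rewrite g0 -[RHS]oppr0 -[in RHS]g0; congr (- g _); ring.
- by congr g; ring.
- by rewrite g0 -[RHS]oppr0 -[in RHS]g0; congr (- g _); ring.
Qed.

Definition blocks (ss : seq word) (hs : seq V) : seq (passage * V) :=
  flatten [seq heights x.2 x.1 | x <- zip ss hs].

Lemma triangle_neq e1 e2 e3 a b c : uniq (flatten (triangle e1 e2 e3 a b c)) ->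
  [/\ a != b, a != c & b != c].
Proof.
by move=> u; split; apply/eqP => E; move: u; rewrite E;
  case: e1; case: e2; case: e3; rewrite /= !inE !eqxx ?orbT ?andbF.
Qed.

(** Reversing the two strands through [a] shifts its passages by the weights of [b] and of [c]. The
    index is preserved when [b] and [c] are both real or both virtual, which holds whenever [a] is
    real; likewise for the other two. *)
Lemma writhe_R3 e1 e2 e3 a b c h1 h2 h3 (s := triangle e1 e2 e3 a b c) :
  (count is_real [:: a; b; c] <= 1)%N \/ all is_real [:: a; b; c] -> uniq (flatten s) ->
  writhe g (blocks s [:: h1; h2; h3]) = writhe g (blocks (map rev s) [:: h1; h2; h3]).
Proof.
move=> real /triangle_neq[ab ac bc].
have [ba ca cb] : [/\ b != a, c != a & c != b] by split; rewrite eq_sym.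
have [ra rb rc] : [/\ is_real a -> mu V b = mu V c, is_real b -> mu V a = mu V c
    & is_real c -> mu V a = mu V b].
  by rewrite /mu; move: real; rewrite /=; case: (is_real a); case: (is_real b); case: (is_real c) => -[].
rewrite {}/s /triangle /blocks; case: e1; case: e2; case: e3 => /=; rewrite ?weightE /=.
all: do 6 pick; rewrite writhe_nil !addr0.
all: same_chord a ra; same_chord b rb; same_chord c rc; ring.
Qed.

Definition unit_valued := forall x, 0 <= g x <= 1.

(** Alternating strands on an incoherent triangle give two crossings of one sign and one of the
    other, whence 2 and not 3. *)
Lemma writhe_wedge e1 e2 e3 a b c h1 h2 h3 (s := triangle e1 e2 e3 a b c) : unit_valued ->
  ((e1 == e2) && (e2 == e3)) = false -> all is_real [:: a; b; c] -> all alternating s ->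
  uniq (flatten s) -> `|writhe g (blocks s [:: h1; h2; h3])| <= 2.
Proof.
move=> g01 co real alt /triangle_neq[ab ac bc].
have [ba ca cb] : [/\ b != a, c != a & c != b] by split; rewrite eq_sym.
move: co alt; rewrite {}/s /triangle /blocks /alternating.
case: e1; case: e2; case: e3 => //= _; rewrite ?weightE /=.
all: do 3 pick; rewrite writhe_nil addr0 /chord /is_over /=.
all: move: real; rewrite /is_real /=; case: (kind a) => // ka;
  case: (kind b) => // kb; case: (kind c) => // kc _.
all: case: ka; case: kb; case: kc => // _.
all: unit_bound g g01.
Qed.

Lemma grid_neq p1 p2 q1 q2 a b c d : uniq (flatten (grid p1 p2 q1 q2 a b c d)) ->
  [/\ a != b, a != c & a != d] /\ [/\ b != c, b != d & c != d].
Proof.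
by move=> u; split; split; apply/eqP => E; move: u; rewrite E;
  case: p1; case: p2; case: q1; case: q2; rewrite /= !inE !eqxx ?orbT ?andbF.
Qed.

(** With parallel strands the four signs agree; with antiparallel ones there are two of each. *)
Lemma writhe_grid p1 p2 q1 q2 a b c d h1 h2 h3 h4 par (s := grid p1 p2 q1 q2 a b c d) :
  unit_valued -> (p1 == p2) = par /\ (q1 == q2) = par ->
  all is_real [:: a; b; c; d] -> all (all is_over) (horizontals p1 p2 q1 q2 a b c d) ->
  uniq (flatten s) ->
  `|writhe g (blocks s [:: h1; h2; h3; h4])| <= if par then 4 else 2.
Proof.
move=> g01 [pp qq] real over /grid_neq[[ab ac ad] [bc bd cd]].
have [ba ca da] : [/\ b != a, c != a & d != a] by split; rewrite eq_sym.
have [cb db dc] : [/\ c != b, d != b & d != c] by split; rewrite eq_sym.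
move: pp qq over; rewrite {}/s /grid /blocks.
case: p1; case: p2 => /= <-; case: q1; case: q2 => //= _; rewrite ?weightE /=.
all: do 4 pick; rewrite writhe_nil addr0 /chord /is_over /=.
all: move: real; rewrite /is_real /=; case: (kind a) => // ka;
  case: (kind b) => // kb; case: (kind c) => // kc; case: (kind d) => // kd _.
all: case: ka; case: kb; case: kc; case: kd => // _.
all: unit_bound g g01.
Qed.
End Moves.

Definition parity (x : 'F_2) : int := if x == 0 then 0 else 1.

Lemma parity01 : unit_valued parity.
Proof. by move=> x; rewrite /parity; case: ifP. Qed.

(** The three signs agree, so counting signs only gives 3. But modulo 2 the indices are [h1 + h3],
    [h1 + h2] and [h2 + h3]: their sum vanishes, so at most two are odd. *)
Lemma writhe_circ e1 e2 e3 a b c h1 h2 h3 (s := triangle e1 e2 e3 a b c) :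
  (e1 == e2) && (e2 == e3) -> all is_real [:: a; b; c] -> all alternating s ->
  uniq (flatten s) -> `|writhe parity (blocks s [:: h1; h2; h3])| <= 2.
Proof.
move=> co real alt /triangle_neq[ab ac bc].
have [ba ca cb] : [/\ b != a, c != a & c != b] by split; rewrite eq_sym.
move: co alt; rewrite {}/s /triangle /blocks /alternating.
case: e1; case: e2; case: e3 => //= _; rewrite ?weightE /=.
all: do 3 pick; rewrite writhe_nil addr0 /chord /is_over /mu /=.
all: move: real; rewrite /is_real /=; case: (kind a) => // ka;
  case: (kind b) => // kb; case: (kind c) => // kc _.
all: case: ka; case: kb; case: kc => // _.
all: have f2 (h : 'F_2) : h = 0 \/ h = 1 by case: h => -[|[|n]] hn //; [left|right]; apply: val_inj.
all: case: (f2 h1) => ->; case: (f2 h2) => ->; case: (f2 h3) => ->; by vm_compute.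
Qed.

(** * Invariance, and change under a move *)

Lemma closed_triangle e1 e2 e3 a b c : other_closed (flatten (triangle e1 e2 e3 a b c)).
Proof.
by rewrite /other_closed; case: e1; case: e2; case: e3; rewrite /= /other /= !inE !eqxx ?orbT.
Qed.

Lemma closed_triangle_rev e1 e2 e3 a b c :
  other_closed (flatten (map rev (triangle e1 e2 e3 a b c))).
Proof.
by rewrite /other_closed; case: e1; case: e2; case: e3; rewrite /= /other /= !inE !eqxx ?orbT.
Qed.

Lemma closed_grid p1 p2 q1 q2 a b c d : other_closed (flatten (grid p1 p2 q1 q2 a b c d)).
Proof.
by rewrite /other_closed; case: p1; case: p2; case: q1; case: q2;
  rewrite /= /other /= !inE !eqxx ?orbT.
Qed.

Lemma closed_R2 a b e f : other_closed ([:: (a, f); (b, ~~ f)] ++ orient e [:: (a, ~~ f); (b, f)]).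
Proof.
by rewrite /other_closed; case: e; case: f; rewrite /= /other /= !inE !eqxx ?orbT.
Qed.

Lemma weights_orient (V : comNzRingType) e s : weights V (orient e s) = weights V s.
Proof. by case: e; rewrite //= weights_rev. Qed.

Section Invariance.
Variables (V : comNzRingType) (g : V -> int).
Hypothesis g0 : g 0 = 0.

Lemma word_writhe_reidemeister t w w' : reidemeister t -> wf_word w -> wf_word w' ->
  replaced t w w' -> word_writhe g w' = word_writhe g w.
Proof.
move=> rt wfw wfw' rep; apply/eqP; rewrite -subr_eq0; apply/eqP.
case: rt => [[a [f tE]]|[a [b [e [f [kb tE]]]]]|[e1 [e2 [e3 [a [b [c [real tE]]]]]]]].
- have [|||zs [zE _ _ ->]] := word_writhe_replaced g wfw wfw' rep.
  + rewrite tE => x; rewrite inE => /eqP -> /=; rewrite weights2 !weightE /weights big_nil.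
    by case: (f) => /=; ring.
  + by rewrite tE.
  + by rewrite tE /other_closed /= /other /= !inE !eqxx ?orbT ?negbK ?eqxx.
  move: zE; rewrite tE; case: zs => [|[x h] [|]] //= [->].
  by rewrite cats0 writhe_R1 // writhe_nil subr0.
- have [|||zs [zE _ u ->]] := word_writhe_replaced g wfw wfw' rep.
  + rewrite tE => x; rewrite !inE => /orP[] /eqP -> /=;
      rewrite ?weights_orient weights2 !weightE /weights big_nil /mu /is_real kb;
      by case: (f) (kind a) => -[[]|] /=; ring.
  + by rewrite tE.
  + by rewrite tE /= cats0; apply: closed_R2.
  move: zE u; rewrite tE; case: zs => [|[x h] [|[y k] [|]]] //= [-> ->].
  by rewrite !cats0 => u; rewrite writhe_nil subr0; apply: writhe_R2.
have fE : map fst t = triangle e1 e2 e3 a b c by rewrite tE.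
have sE : map snd t = map rev (triangle e1 e2 e3 a b c) by rewrite tE.
have [|||zs [zE u _ ->]] := word_writhe_replaced g wfw wfw' rep.
- by rewrite tE => x /mapP[y _ ->] /=; rewrite weights_rev.
- by rewrite fE; apply: closed_triangle.
- by rewrite sE; apply: closed_triangle_rev.
move: zE u; rewrite fE tE; case: zs => [|[x h1] [|[y h2] [|[z h3] [|]]]] //= [-> -> ->] u.
have r' : (count is_real [:: a; b; c] <= 1)%N \/ all is_real [:: a; b; c].
  by case: real => [|[]]; [left|right].
have := @writhe_R3 V g e1 e2 e3 a b c h1 h2 h3 r' u.
by rewrite /blocks /= => ->; rewrite subrr.
Qed.

Definition diagram_writhe (D : diagram) : int := word_writhe g (code D).

Lemma diagram_writhe_elementary D D' : elementary D D' -> diagram_writhe D = diagram_writhe D'.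
Proof.
rewrite /diagram_writhe; case=> [[f [fi fk -> _]]|[i0 [i [_ -> _]]]|[_ [t rt rep]]].
- by rewrite word_writhe_renaming.
- by rewrite word_writhe_rot //; apply: code_wf.
by case: rep => rep; [symmetry|]; apply: word_writhe_reidemeister rt _ _ rep; apply: code_wf.
Qed.

Lemma diagram_writhe_equivalent D D' : equivalent D D' -> diagram_writhe D = diagram_writhe D'.
Proof.
by elim=> {D D'} [D D' /diagram_writhe_elementary| |D D' _ ->|D D' D'' _ -> _ ->].
Qed.
End Invariance.

Definition step (X : vmove) : int :=
  match X with VDeltaWedge | VDeltaCirc | VPass => 2 | VSharp => 4 end.

Lemma weights_F2 p q : is_real p.1 -> is_real q.1 -> weights 'F_2 [:: p; q] = 0.
Proof.
rewrite weights2 [p]surjective_pairing [q]surjective_pairing !weightE /mu /= => -> ->.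
case: p.2; case: q.2; apply: val_inj; vm_compute; reflexivity.
Qed.

Lemma weights_virtual p q : is_virtual p.1 -> is_virtual q.1 -> weights 'F_2 [:: p; q] = 0.
Proof. by rewrite weights2 /weight => -> ->; rewrite addr0. Qed.

Lemma word_writhe_vmove X t w w' : vmove_template X t -> wf_word w -> wf_word w' ->
  replaced t w w' -> `|word_writhe parity w' - word_writhe parity w| <= step X.
Proof.
have bound_vdelta co : vdelta co t -> wf_word w -> wf_word w' ->
    replaced t w w' -> `|word_writhe parity w' - word_writhe parity w| <= 2.
  case=> e1 [e2 [e3 [a [b [c [a' [b' [c' [coE real alt virt tE]]]]]]]]] wfw wfw' rep.
  have fE : map fst t = triangle e1 e2 e3 a b c by rewrite tE.
  have sE : map snd t = triangle e1 e2 e3 a' b' c' by rewrite tE.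
  have [|||zs [zE u _ ->]] := word_writhe_replaced parity wfw wfw' rep.
  - case/and4P: real => ra rb rc _; case/and4P: virt => va vb vc _.
    by rewrite tE => x; rewrite !inE => /or3P[] /eqP -> /=;
      rewrite !weights_orient weights_F2 // weights_virtual.
  - by rewrite fE; apply: closed_triangle.
  - by rewrite sE; apply: closed_triangle.
  move: zE u; rewrite fE tE; case: zs => [|[x h1] [|[y h2] [|[z h3] [|]]]] //= [-> -> ->] u.
  rewrite [X in X - _]writhe_virtual ?sub0r ?normrN; last first.
    case/and4P: virt => va vb vc _.
    by case: (e1); case: (e2); case: (e3); rewrite /= va vb vc.
  case: co coE => coE.
    by have := @writhe_circ e1 e2 e3 a b c h1 h2 h3 coE real alt u.
  by have := @writhe_wedge _ parity e1 e2 e3 a b c h1 h2 h3 parity01 coE real alt u.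
have bound_vgrid par : vgrid par t -> wf_word w -> wf_word w' ->
    replaced t w w' -> `|word_writhe parity w' - word_writhe parity w| <= if par then 4 else 2.
  case=> p1 [p2 [q1 [q2 [a [b [c [d [a' [b' [c' [d' [pq real over virt tE]]]]]]]]]]]] wfw wfw' rep.
  have fE : map fst t = grid p1 p2 q1 q2 a b c d by rewrite tE.
  have sE : map snd t = grid p1 p2 q1 q2 a' b' c' d' by rewrite tE.
  have [|||zs [zE u _ ->]] := word_writhe_replaced parity wfw wfw' rep.
  - case/and5P: real => ra rb rc rd _; case/and5P: virt => va vb vc vd _.
    by rewrite tE => x; rewrite !inE => /or4P[] /eqP -> /=;
      rewrite !weights_orient weights_F2 // weights_virtual.
  - by rewrite fE; apply: closed_grid.
  - by rewrite sE; apply: closed_grid.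
  move: zE u; rewrite fE tE.
  case: zs => [|[x h1] [|[y h2] [|[z h3] [|[z4 h4] [|]]]]] //= [-> -> -> ->] u.
  rewrite [X in X - _]writhe_virtual ?sub0r ?normrN; last first.
    case/and5P: virt => va vb vc vd _.
    by case: (p1); case: (p2); case: (q1); case: (q2); rewrite /= va vb vc vd.
  by have := @writhe_grid _ parity p1 p2 q1 q2 a b c d h1 h2 h3 h4 par parity01 pq real over u.
by case: X => /=;
  [apply: bound_vdelta|apply: bound_vdelta|apply: (bound_vgrid true)|apply: (bound_vgrid false)].
Qed.

Lemma diagram_writhe_deforms X n D D' : deforms X n D D' ->
  `|diagram_writhe parity D' - diagram_writhe parity D| <= step X * n%:Z.
Proof.
have par0 : parity 0 = 0 by [].
elim=> {n D D'} [D D' /(diagram_writhe_equivalent par0) ->|n D D1 D2 D' _ IH [_ [t Xt rep]]].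
  by rewrite subrr mulr0.
move/(diagram_writhe_equivalent par0) => <-.
have h : `|diagram_writhe parity D2 - diagram_writhe parity D1| <= step X.
  case: rep => rep; first exact: word_writhe_vmove Xt (code_wf _) (code_wf _) rep.
  by rewrite distrC; apply: word_writhe_vmove Xt (code_wf _) (code_wf _) rep.
have -> : step X * n.+1%:Z = step X + step X * n%:Z by rewrite intS; ring.
move: (diagram_writhe _ D) (diagram_writhe _ D1) (diagram_writhe _ D2) IH h => x y z; lia.
Qed.

(** * One more move, with arbitrarily large effect *)

Definition pairs (cs : seq crossing) : word := flatten [seq [:: (c, true); (c, false)] | c <- cs].

Lemma wf_pairs cs w : wf_word w -> uniq cs -> {in cs, forall c, c \notin map fst w} ->
  wf_word (pairs cs ++ w).
Proof.
move=> wfw; elim: cs => //= c cs IH /andP[cn ucs] h.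
rewrite (_ : [:: (c, true), (c, false) & _] = [:: (c, true), other (c, true) & pairs cs ++ w]) //.
rewrite wf_pair IH //; last by move=> d dcs; apply: h; rewrite inE dcs orbT.
rewrite /= map_cat mem_cat negb_or h ?mem_head // andbT.
apply: contra cn; elim: (cs) => //= d ds IHd; rewrite !inE.
by case/or3P=> [->//|->//|/IHd ->]; rewrite orbT.
Qed.

Definition below (N : nat) (w : word) := all (fun p : passage => p.1.1 < N)%N w.

Lemma below_exists w : exists N, below N w.
Proof.
elim: w => [|p w [N h]]; first by exists 0%N.
exists (maxn N p.1.1.+1); rewrite /= leq_max ltnSn orbT /=.
by apply: sub_all h => q; rewrite leq_max => ->.
Qed.

Lemma perm_chain_pairs z : perm_eq (z ++ mirror z) (pairs (map fst z)).
Proof.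
elim/last_ind: z => // z p IH; have := perm_mirror z p [::]; rewrite !cats0 => h.
apply: perm_trans h _; rewrite map_rcons -cats1 /pairs map_cat flatten_cat /= -/(pairs _).
move/permP: IH => IH; apply/permP => Q; have := IH Q.
case: p => c [] /=; rewrite /other /= !count_cat /= => ->; lia.
Qed.

(** Freshness is read off the numbers alone, so it holds for every choice of kinds; the word before
    the move and the word after it are covered alike. *)
Lemma wf_block s t z w cs N k : perm_eq (s ++ t) (pairs cs) ->
  map fst (cs ++ map fst z) = iota N k -> below N w -> wf_word w ->
  wf_word (s ++ z ++ t ++ mirror z ++ w) /\ wf_word (z ++ mirror z ++ w).
Proof.
move=> pst nm bw wfw.
have ucz : uniq (cs ++ map fst z) by apply: (@map_uniq _ _ fst); rewrite nm iota_uniq.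
have fresh c : c \in cs ++ map fst z -> c \notin map fst w.
  move=> cin; apply/mapP => -[p pw cE]; have := map_f fst cin.
  by rewrite nm mem_iota => /andP[+ _]; move/allP: bw => /(_ p pw); rewrite cE ltnNge => /negbTE ->.
have wfp ds : uniq ds -> {subset ds <= cs ++ map fst z} -> wf_word (pairs ds ++ w).
  by move=> uds sub; apply: wf_pairs => // c /sub; apply: fresh.
move/permP: pst => pst; move/permP: (perm_chain_pairs z) => pz; split.
  rewrite (wf_perm (w' := pairs (cs ++ map fst z) ++ w)); first exact: wfp.
  rewrite /pairs map_cat flatten_cat -!/(pairs _); apply/permP => Q.
  by move: (pst Q) (pz Q); rewrite !count_cat; lia.
rewrite (wf_perm (w' := pairs (map fst z) ++ w)).
  by apply: wfp => [|c cz]; [move: ucz; rewrite cat_uniq => /and3P[]|rewrite mem_cat cz orbT].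
by apply/permP => Q; move: (pz Q); rewrite !count_cat; lia.
Qed.

(** Alternation forces side [false] on every second letter. A real crossing there would weigh -1 and
    cancel its predecessor, so these crossings are virtual and the weights add up to [n]. *)
Fixpoint chain (N n : nat) : word :=
  if n is n'.+1 then [:: ((N, Some true), true), ((N.+1, None), false) & chain N.+2 n'] else [::].

Lemma chain_names N n : map fst (map fst (chain N n)) = iota N n.*2.
Proof. by elim: n N => //= n IH N; rewrite IH. Qed.

Lemma chain_size N n : size (chain N n) = n.*2.
Proof. by rewrite -(size_map fst) -(size_map fst) chain_names size_iota. Qed.

Lemma chain_alternates N n : alternates true (chain N n).
Proof. by elim: n N => //= n IH N; rewrite IH. Qed.

Lemma chain_weights (V : comNzRingType) N n : weights V (chain N n) = n%:R.
Proof.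
elim: n N => [|n IH] N; first by rewrite /weights big_nil.
rewrite -[chain N n.+1]/([:: _; _] ++ chain N.+2 n) weights_cat weights2 IH.
by rewrite /weight /= /sgn addr0 -natr1 addrC.
Qed.

Section Value.
Variables (V : comNzRingType) (g : V -> int).
Hypothesis g0 : g 0 = 0.

(** As [s] and [t] have weight zero, the chain and [w] keep the heights they have without them, and
    the chain alone is removable by Reidemeister moves. *)
Lemma word_writhe_block s t z w : alternates true z -> wf_word (s ++ z ++ t ++ mirror z ++ w) ->
  wf_word (z ++ mirror z ++ w) ->
  drawn w -> weights V s = 0 -> weights V t = 0 -> other_closed (s ++ t) ->
  word_writhe g (s ++ z ++ t ++ mirror z ++ w) =
  word_writhe g w + writhe g (heights 0 s ++ heights (weights V z) t).
Proof.
move=> az wfW wfz dw ws wt cl.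
have <- : word_writhe g (z ++ mirror z ++ w) = word_writhe g w.
  have := diagram_writhe_equivalent g0 (equivalent_chain az wfz dw).
  by rewrite /diagram_writhe !diagram_ofK //; apply: drawn_chain.
have pW : perm_eq (heights (0 : V) (s ++ z ++ t ++ mirror z ++ w))
    (heights 0 (z ++ mirror z ++ w) ++ heights 0 s ++ heights (weights V z) t).
  rewrite !heights_cat ws wt !addr0 !add0r; apply/permP => Q.
  by rewrite !count_cat; lia.
rewrite /word_writhe (writhe_perm _ pW) writhe_cat_closed ?map_cat ?heights_fst //.
rewrite (perm_uniq (_ : perm_eq _ (s ++ z ++ t ++ mirror z ++ w))); first by case/andP: wfW.
by apply/permP => Q; rewrite !count_cat; lia.
Qed.
End Value.

Definition sq (x : int) : int := x ^+ 2.

Ltac pick_named := pick_with ltac:(rewrite ?inE ?xpair_eqE ?eqn_add2l).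

Lemma F2_cases (h : 'F_2) : h = 0 \/ h = 1.
Proof. by case: h => -[|[|n]] hn //; [left|right]; apply: val_inj. Qed.

Lemma natr_double_F2 j : (j.*2)%:R = 0 :> 'F_2.
Proof. by rewrite -addnn natrD; case: (F2_cases j%:R) => ->; apply: val_inj. Qed.

Lemma natr_odd_F2 j : (j.*2.+1)%:R = 1 :> 'F_2.
Proof. by rewrite -natr1 natr_double_F2 add0r. Qed.

Lemma block_step X tpl s t s' t' z w v
  (W := s ++ z ++ t ++ mirror z ++ w) (W' := s' ++ z ++ t' ++ mirror z ++ w) :
  alternates true z -> drawn w -> wf_word (z ++ mirror z ++ w) ->
  drawn W -> drawn W' -> equivalent (diagram_of W') (diagram_of w) ->
  vmove_template X tpl -> replaced tpl W W' -> other_closed (s ++ t) ->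
  (forall V : comNzRingType, weights V s = 0 /\ weights V t = 0) ->
  writhe parity (heights 0 s ++ heights (weights _ z) t) = step X ->
  writhe sq (heights 0 s ++ heights (weights _ z) t) = v ->
  exists w', [/\ drawn w', deforms X 1 (diagram_of w') (diagram_of w),
    word_writhe parity w' = word_writhe parity w + step X & word_writhe sq w' = word_writhe sq w + v].
Proof.
move=> az dw wfz dW dW' eqW' Xt rep cl wst val1 val2; exists W; split=> //.
- apply: (deformsS (D1 := diagram_of W) (D2 := diagram_of W')) eqW'.
    by apply: deforms0; apply: rst_refl.
  by apply: (local_move_of dW dW' Xt); left.
- by rewrite -val1; case: (wst 'F_2) => ws wt; apply: word_writhe_block => //; case: dW.
- by rewrite -val2; case: (wst int) => ws wt; apply: word_writhe_block => //; case: dW.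
Qed.

Definition gain (X : vmove) (j : nat) : int :=
  match X with
  | VDeltaWedge | VDeltaCirc => 2 * (j.*2.+1)%:R ^+ 2
  | VSharp => 2 * (j.*2.+1)%:R ^+ 2 + 2
  | VPass => - 2 * (j.*2.+1)%:R ^+ 2
  end.

Definition has_step X w j := exists w', [/\ drawn w', deforms X 1 (diagram_of w') (diagram_of w),
    word_writhe parity w' = word_writhe parity w + step X &
    word_writhe sq w' = word_writhe sq w + gain X j].

Definition name (N i : nat) (k : option bool) : crossing := ((N + i)%N, k).

Ltac eval_weights := move=> V; split; rewrite /weights !big_cons big_nil /weight /sgn /=; ring.
Ltac eval_writhe := rewrite /= !weightE /= /name; do ?pick_named;
  rewrite writhe_nil /chord /mu /is_real /=.

(** The positive crossings [a], [b], [c] have indices 0, [n] and [-n], so [n] has to be odd. *)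
Lemma circ_step w j : drawn w -> has_step VDeltaCirc w j.
Proof.
move=> dw; have [N bw] := below_exists w.
pose n := j.*2.+1; pose z := chain (N + 3) n.
pose top k := circ_word z w (name N 0 k) (name N 1 k) (name N 2 k).
have az : alternates true z by apply: chain_alternates.
have ez : ~~ odd (size z) by rewrite chain_size odd_double.
have wft k : wf_word (top k) /\ wf_word (z ++ mirror z ++ w).
  apply: (@wf_block _ _ _ _ [:: name N 0 k; name N 1 k; name N 2 k] N (3 + n.*2)) => //.
  - by apply/permP => Q; perm_lia Q.
  - by rewrite map_cat chain_names iotaD /= addn0 addn1 addn2.
  - by case: dw.
have [dt _] := circ_drawn (isT : z != [::]) az dw ez (wft (Some true)).1.
have [dv /(_ isT) eqv] := circ_drawn (isT : z != [::]) az dw ez (wft None).1.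
pose tri k := triangle true true true (name N 0 k) (name N 1 k) (name N 2 k).
apply: (block_step (tpl := zip (tri (Some true)) (tri None)) az dw (wft None).2 dt dv eqv).
- by exists true, true, true; do 6 eexists; split; last reflexivity.
(* The order in which the word visits the strands of the template. *)
- exists [seq nth ([::], [::]) (zip (tri (Some true)) (tri None)) i | i <- [:: 2; 0; 1]%N].
  exists [::], [:: [::]; z; mirror z ++ w].
  by split=> //=; [apply/permP => Q; perm_lia Q | rewrite cats0 | rewrite cats0].
- by rewrite /other_closed /= /other /= !inE !eqxx ?orbT.
- by eval_weights.
- by rewrite chain_weights natr_odd_F2; eval_writhe; vm_compute.
- by rewrite chain_weights; eval_writhe; rewrite /sq /gain /n; ring.
Qed.

(** The positive crossings [a] and [c] have indices [n - 1] and [1 - n], the negative kink [b] has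
    index 0, so [n] has to be even. *)
Lemma wedge_step w j : drawn w -> has_step VDeltaWedge w j.
Proof.
move=> dw; have [N bw] := below_exists w.
(* The additional virtual letter makes the length of the chain odd without changing its weight. *)
pose n := j.+1.*2; pose z := rcons (chain (N + 3) n) ((N + 3 + n.*2, None)%N, true).
pose top k l := wedge_word z w (name N 0 k) (name N 1 l) (name N 2 k).
have az : alternates true z by rewrite alternates_rcons chain_alternates chain_size odd_double.
have oz : odd (size z) by rewrite size_rcons chain_size oddS odd_double.
have wz (V : comNzRingType) : weights V z = n%:R.
  by rewrite /z -cats1 weights_cat chain_weights /weights big_cons big_nil /weight /= !addr0.
have wft k l : wf_word (top k l) /\ wf_word (z ++ mirror z ++ w).
  apply: (@wf_block _ _ _ _ [:: name N 0 k; name N 1 l; name N 2 k] N (3 + n.*2.+1)) => //.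
  - by apply/permP => Q; perm_lia Q.
  - have -> : (3 + n.*2.+1 = 3 + n.*2 + 1)%N by lia.
    by rewrite map_cat /z !map_rcons chain_names !iotaD /= -cats1 addn0 addn1 addn2 addnA.
  - by case: dw.
have [dt _] := wedge_drawn (isT : z != [::]) az dw oz (wft (Some true) (Some false)).1.
have [dv /(_ isT) eqv] := wedge_drawn (isT : z != [::]) az dw oz (wft None None).1.
pose tri k l := triangle true true false (name N 0 k) (name N 1 l) (name N 2 k).
pose tpl := zip (tri (Some true) (Some false)) (tri None None).
apply: (block_step (tpl := tpl) az dw (wft None None).2 dt dv eqv).
- by exists true, true, false; do 6 eexists; split; last reflexivity.
- exists tpl, [::], [:: [::]; z; mirror z ++ w].
  by split=> //=; rewrite cats0.
- by rewrite /other_closed /= /other /= !inE !eqxx ?orbT.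
- by eval_weights.
- by rewrite wz natr_double_F2; eval_writhe; vm_compute.
- by rewrite wz; eval_writhe; rewrite /sq /gain /n doubleS -!natr1; ring.
Qed.

(** The positive crossings [a], [b], [c], [d] have indices 1, [n], [-n] and -1: all four are odd as
    soon as [n] is. *)
Lemma sharp_step w j : drawn w -> has_step VSharp w j.
Proof.
move=> dw; have [N bw] := below_exists w.
pose n := j.*2.+1; pose z := chain (N + 6) n.
pose top k := sharp_word z w (name N 0 k) (name N 1 k) (name N 2 k) (name N 3 k)
  (name N 4 None) (name N 5 None).
have az : alternates true z by apply: chain_alternates.
have ez : ~~ odd (size z) by rewrite chain_size odd_double.
have wft k : wf_word (top k) /\ wf_word (z ++ mirror z ++ w).
  apply: (@wf_block _ _ _ _ [:: name N 0 k; name N 1 k; name N 2 k; name N 3 k;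
    name N 4 None; name N 5 None] N (6 + n.*2)) => //.
  - by apply/permP => Q; perm_lia Q.
  - by rewrite map_cat chain_names iotaD /= addn0 !addnS addn0.
  - by case: dw.
have [dt _] := sharp_drawn (isT : z != [::]) az dw ez (wft (Some true)).1.
have [dv /(_ isT) eqv] := sharp_drawn (isT : z != [::]) az dw ez (wft None).1.
pose gr k := grid true true true true (name N 0 k) (name N 1 k) (name N 2 k) (name N 3 k).
apply: (block_step (tpl := zip (gr (Some true)) (gr None)) az dw (wft None).2 dt dv eqv).
- by exists true, true, true, true; do 8 eexists; split; last reflexivity.
- exists [seq nth ([::], [::]) (zip (gr (Some true)) (gr None)) i | i <- [:: 2; 0; 3; 1]%N].
  exists [:: (name N 4 None, false)],
    [:: [:: (name N 5 None, true)]; z; [:: (name N 5 None, false)];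
        (name N 4 None, true) :: mirror z ++ w].
  by split=> //=; [apply/permP => Q; perm_lia Q | rewrite cats0 | rewrite cats0].
- by rewrite /other_closed /= /other /= !inE !eqxx ?orbT.
- by eval_weights.
- by rewrite chain_weights natr_odd_F2; eval_writhe; vm_compute.
- by rewrite chain_weights; eval_writhe; rewrite /sq /gain /n; ring.
Qed.

(** The positive crossings [a] and [d] have index -1, the negative ones [b] and [c] have [n - 1] and
    [-n - 1]. An odd [n] makes the negative ones even, so they cannot cancel the positive ones
    modulo 2; the squares sum to [- 2 * n ^ 2]. *)
Lemma pass_step w j : drawn w -> has_step VPass w j.
Proof.
move=> dw; have [N bw] := below_exists w.
pose n := j.*2.+1; pose z := chain (N + 6) n.
pose top k l := pass_word z w (name N 0 k) (name N 1 l) (name N 2 l) (name N 3 k)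
  (name N 4 None) (name N 5 None).
have az : alternates true z by apply: chain_alternates.
have ez : ~~ odd (size z) by rewrite chain_size odd_double.
have wft k l : wf_word (top k l) /\ wf_word (z ++ mirror z ++ w).
  apply: (@wf_block _ _ _ _ [:: name N 0 k; name N 1 l; name N 2 l; name N 3 k;
    name N 4 None; name N 5 None] N (6 + n.*2)) => //.
  - by apply/permP => Q; perm_lia Q.
  - by rewrite map_cat chain_names iotaD /= addn0 !addnS addn0.
  - by case: dw.
have [dt _] := pass_drawn (isT : z != [::]) az dw ez (wft (Some true) (Some false)).1.
have [dv /(_ isT) eqv] := pass_drawn (isT : z != [::]) az dw ez (wft None None).1.
pose gr k l := grid true false true false (name N 0 k) (name N 1 l) (name N 2 l) (name N 3 k).
pose tpl := zip (gr (Some true) (Some false)) (gr None None).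
apply: (block_step (tpl := tpl) az dw (wft None None).2 dt dv eqv).
- by exists true, false, true, false; do 8 eexists; split; last reflexivity.
- exists [seq nth ([::], [::]) tpl i | i <- [:: 0; 2; 3; 1]%N].
  exists [:: (name N 4 None, false)],
    [:: [:: (name N 5 None, true)]; z; [:: (name N 5 None, false)];
        (name N 4 None, true) :: mirror z ++ w].
  by split=> //=; [apply/permP => Q; perm_lia Q | rewrite cats0 | rewrite cats0].
- by rewrite /other_closed /= /other /= !inE !eqxx ?orbT.
- by eval_weights.
- by rewrite chain_weights natr_odd_F2; eval_writhe; vm_compute.
- by rewrite chain_weights; eval_writhe; rewrite /sq /gain /n; ring.
Qed.

Local Close Scope ring_scope.

(** * Towers of blocks and infinitely many knots *)

Lemma step_exists X w j : drawn w -> has_step X w j.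
Proof.
by case: X; [apply: wedge_step|apply: circ_step|apply: sharp_step|apply: pass_step].
Qed.

Lemma gain_inj X : injective (gain X).
Proof. by case: X => i j /=; rewrite /gain; nia. Qed.

Lemma deforms_equivalent X n D D1 D2 : deforms X n D D1 -> equivalent D1 D2 -> deforms X n D D2.
Proof.
move=> d; case: d => {n D D1} [D D1 e|n D D1 D3 D4 d m e] e'.
  by apply: deforms0; apply: rst_trans e e'.
by apply: (deformsS d m); apply: rst_trans e e'.
Qed.

Lemma deforms_trans X m n D1 D2 D3 :
  deforms X m D1 D2 -> deforms X n D2 D3 -> deforms X (m + n) D1 D3.
Proof.
move=> d1 d2; elim: d2 d1 => {n D2 D3} [D D' e|n D D' D'' D3 _ IH lm e] d1.
  by rewrite addn0; apply: deforms_equivalent e.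
by rewrite addnS; apply: deformsS lm e; apply: IH.
Qed.

Lemma tower X m : exists w, [/\ drawn w, deforms X m (diagram_of w) circle &
  word_writhe parity w = step X * m%:Z]%R.
Proof.
elim: m => [|m [w [dw def val]]].
  exists [::]; split.
  - by split=> //; left.
  - by rewrite diagram_of_nil; apply: deforms0; apply: rst_refl.
  - by rewrite mulr0 /word_writhe writhe_nil.
have [w' [dw' def' val' _]] := step_exists X 0 dw.
exists w'; split=> //; first by rewrite -add1n; apply: deforms_trans def' def.
by rewrite val' val intS; ring.
Qed.

Lemma step_gt0 X : (0 < step X)%R.
Proof. by case: X. Qed.

Local Open Scope classical_set_scope.

Theorem theorem1p3 (X : vmove) (m : nat) (hm : 0 < m) :
  infinite_set [set K : set diagram | virtual_knot K /\ unknotting_number_is X K m].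
Proof.
(* The tower accounts for all moves but one; only the block on top depends on [j]. *)
case: m hm => // m _; have [w [dw def val]] := tower X m.
have [W WP] := choice (fun j => step_exists X j dw).
pose K j := knot_of (diagram_of (W j)).
have par0 : parity 0%R = 0%R by [].
have sq0 : sq 0%R = 0%R by [].
have K_inj : injective K.
  move=> i j Kij; have [[dwi _ _ gi] [dwj _ _ gj]] := (WP i, WP j).
  have : K j (diagram_of (W j)) by apply: rst_refl.
  rewrite -Kij => /(diagram_writhe_equivalent sq0); rewrite /diagram_writhe !diagram_ofK // gi gj.
  by move/addrI/gain_inj.
move=> fin; apply: infinite_nat.
suff -> : [set: nat] = K @^-1` [set K | virtual_knot K /\ unknotting_number_is X K m.+1].
  by apply: finite_preimage fin => i j _ _; apply: K_inj.
apply/seteqP; split=> // j _; split; first by exists (diagram_of (W j)).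
have [dwj defj vj _] := WP j; split.
  exists (diagram_of (W j)), circle; split; try exact: rst_refl.
  by rewrite -add1n; apply: deforms_trans defj def.
move=> n [D [D' [KD OD' dDD']]].
have := diagram_writhe_deforms dDD';
rewrite -(diagram_writhe_equivalent par0 KD) -(diagram_writhe_equivalent par0 OD').
rewrite /diagram_writhe diagram_ofK // vj val /= /word_writhe writhe_nil sub0r normrN.
move: (step_gt0 X); move: (step X) => s s0 h.
(* The parity writhe has to fall from [s * m.+1] to 0, by at most [s] per move. *)
have : (s * m.+1%:Z <= s * n%:Z)%R by rewrite intS; move: h; rewrite ger0_norm; nia.
by rewrite ler_pM2l.
Qed.
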